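(* Let $\beta_0\in[0,\frac\pi2]$ be defined by $\cos(2\beta_0)=-\frac{1}{\sqrt3}$. For the moduli space $\mathcal{M}(0,\frac{2\pi}{3},\frac{4\pi}{3})=\{\rho(\alpha,\beta):(\alpha,\beta)\in[0,\frac\pi2]^2\}$ and for any $\beta\in[0,\frac\pi2]$ with $\beta\neq\beta_0$, there is a neighborhood $\mathcal{N}$ of the point $(\frac{\pi}{2},\beta)$ in $[0,\frac{\pi}{2}]^2$ such that the representation corresponding to any point of $\mathcal{N}$ is discrete and faithful.
   Context: $\mathbf{PSL}(2,\mathbb{Z})=\langle a_0,a_1,a_2\mid a_2^2=a_1^3=1,\ a_2a_1=a_0\rangle$. $\mathbb{C}^{3,1}$ is $\mathbb{C}^4$ with the Hermitian form $\langle z,w\rangle=z_1\overline{w_4}+z_2\overline{w_2}+z_3\overline{w_3}+z_4\overline{w_1}$; $\mathbf{H}^3_{\mathbb C}\subset\mathbb{CP}^3$ is the set of negative lines and $\mathbf{PU}(3,1)$ its group of holomorphic isometries. For $(\alpha,\beta)\in[0,\frac{\pi}{2}]^2$ put $$M_0=\begin{pmatrix}0&0&0&1\\0&1&0&0\\0&0&1&0\\1&0&0&0\end{pmatrix},\quad M_1=\mathrm{diag}(1,-1,1,1),\quad U=\begin{pmatrix}1&0&0&0\\0&\cos\beta&-\sin\beta&0\\0&\sin\beta&\cos\beta&0\\0&0&0&1\end{pmatrix},$$ $$M_2(\alpha,0)=\begin{pmatrix}1&u&0&-e^{-i\alpha}\\0&e^{-i\alpha}&0&u\\0&0&-e^{-i\alpha/3}&0\\0&0&0&1\end{pmatrix},\quad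 u=i e^{-i\alpha/2}\sqrt{2\cos\alpha},\quad M_2=UM_2(\alpha,0)U^{-1}.$$ Let $\iota_j$ be the anti-holomorphic isometry of $\mathbf{H}^3_{\mathbb C}$ induced by $z\mapsto M_j\bar z$. The representation $\rho(\alpha,\beta):\mathbf{PSL}(2,\mathbb{Z})\to\mathbf{PU}(3,1)$ is $a_2\mapsto A_2=\iota_1\iota_0$, $a_1\mapsto A_1=\iota_0\iota_2$, $a_0\mapsto A_0=\iota_1\iota_2$ (the classes of $M_1\overline{M_0}$, $M_0\overline{M_2}$, $M_1\overline{M_2}$). *)

(* Defs.v *)
From HB Require Import structures.
From mathcomp Require Import all_boot all_order all_algebra.
From mathcomp Require Import generic_quotient complex.
From mathcomp Require Import all_classical all_reals all_analysis.
From mathcomp Require Import ring lra.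

Set Implicit Arguments.
Unset Strict Implicit.
Unset Printing Implicit Defensive.

Import Order.TTheory GRing.Theory Num.Theory.
Import numFieldNormedType.Exports.

Local Open Scope classical_set_scope.
Local Open Scope ring_scope.
Local Open Scope complex_scope.

Variant gen := a0 | a1 | a2.
Definition nat_of_gen (g : gen) : nat :=
  match g with a0 => 0 | a1 => 1 | a2 => 2 end.
Definition gen_of_nat (n : nat) : gen :=
  match n with 0 => a0 | 1 => a1 | _ => a2 end%N.
Lemma nat_of_genK : cancel nat_of_gen gen_of_nat.
Proof. by case. Qed.
HB.instance Definition _ := Choice.copy gen (can_type nat_of_genK).

(* The letter (g, false) stands for g and (g, true) for its formal inverse. *)
Definition letter := (gen * bool)%type.
Definition word := seq letter.

(* The congruence on words presenting
   < a0, a1, a2 | a2^2 = a1^3 = 1, a2 a1 = a0 >. *)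
Inductive word_eq : word -> word -> Prop :=
| word_eq_refl w : word_eq w w
| word_eq_sym w w' : word_eq w w' -> word_eq w' w
| word_eq_trans w1 w2 w3 : word_eq w1 w2 -> word_eq w2 w3 -> word_eq w1 w3
| word_eq_cat v v' w w' :
    word_eq v v' -> word_eq w w' -> word_eq (v ++ w) (v' ++ w')
| word_eq_cancel g s : word_eq [:: (g, s); (g, ~~ s)] [::]
| word_eq_a2 : word_eq [:: (a2, false); (a2, false)] [::]
| word_eq_a1 : word_eq [:: (a1, false); (a1, false); (a1, false)] [::]
| word_eq_a0 : word_eq [:: (a2, false); (a1, false)] [:: (a0, false)].

Definition word_eqb : rel word := fun v w => `[< word_eq v w >].

Lemma word_eqb_refl : reflexive word_eqb.
Proof. by move=> w; apply/asboolP; exact: word_eq_refl. Qed.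
Lemma word_eqb_sym : symmetric word_eqb.
Proof. by move=> v w; apply/asboolP/asboolP; exact: word_eq_sym. Qed.
Lemma word_eqb_trans : transitive word_eqb.
Proof.
by move=> v u w /asboolP uv /asboolP vw; apply/asboolP; exact: word_eq_trans vw.
Qed.
Canonical word_equiv := EquivRel word_eqb
  word_eqb_refl word_eqb_sym word_eqb_trans.

Definition PSL2Z := {eq_quot word_equiv}%qT.
HB.instance Definition _ := Choice.on PSL2Z.
HB.instance Definition _ := EqQuotient.on PSL2Z.

Definition word_inv (w : word) : word := rev [seq (l.1, ~~ l.2) | l <- w].

Lemma PSL2Z_eqP (v w : word) :
  \pi_PSL2Z%qT v = \pi_PSL2Z%qT w <-> word_eq v w.
Proof.
split => [/eqmodP /asboolP //|vw].
by apply/eqmodP; apply/asboolP.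
Qed.

Lemma PSL2Z_repr (w : word) : word_eq (repr (\pi_PSL2Z%qT w)) w.
Proof. by apply/PSL2Z_eqP; rewrite reprK. Qed.

Lemma word_invK : involutive word_inv.
Proof.
move=> w; rewrite /word_inv map_rev revK -map_comp -[RHS]map_id.
by apply: eq_map => -[j s] /=; rewrite negbK.
Qed.

Lemma word_eq_mulV w : word_eq (w ++ word_inv w) [::].
Proof.
elim: w => [|[j s] w IH]; first exact: word_eq_refl.
rewrite /word_inv /= rev_cons -cats1 catA -/(word_inv w) -cat1s.
apply: word_eq_trans (word_eq_cancel j s).
rewrite -[X in word_eq _ X]/([:: (j, s)] ++ ([::] ++ [:: (j, ~~ s)])).
rewrite -catA; apply: word_eq_cat; first exact: word_eq_refl.
by rewrite catA; apply: word_eq_cat => //; exact: word_eq_refl.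
Qed.

Lemma word_eq_Vmul w : word_eq (word_inv w ++ w) [::].
Proof. by rewrite -{2}(word_invK w); exact: word_eq_mulV. Qed.

Lemma word_eq_inv v w : word_eq v w -> word_eq (word_inv v) (word_inv w).
Proof.
move=> vw.
have h1 : word_eq (word_inv v ++ (w ++ word_inv w)) (word_inv v).
  rewrite -[X in word_eq _ X]cats0.
  by apply: word_eq_cat; [exact: word_eq_refl|exact: word_eq_mulV].
apply: word_eq_trans (word_eq_sym h1) _; rewrite catA -[X in word_eq _ X]cat0s.
apply: word_eq_cat; last exact: word_eq_refl.
apply: word_eq_trans (word_eq_Vmul v).
by apply: word_eq_cat; [exact: word_eq_refl|exact: word_eq_sym].
Qed.

Definition PSL2Z_one : PSL2Z := \pi_PSL2Z%qT [::].
Definition PSL2Z_mul (x y : PSL2Z) : PSL2Z := \pi_PSL2Z%qT (repr x ++ repr y).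
Definition PSL2Z_inv (x : PSL2Z) : PSL2Z := \pi_PSL2Z%qT (word_inv (repr x)).

Lemma PSL2Z_mulA : associative PSL2Z_mul.
Proof.
move=> x y z; apply/PSL2Z_eqP.
apply: (@word_eq_trans _ (repr x ++ (repr y ++ repr z))).
  by apply: word_eq_cat; [exact: word_eq_refl|exact: PSL2Z_repr].
rewrite catA; apply: word_eq_cat; last exact: word_eq_refl.
by apply: word_eq_sym; exact: PSL2Z_repr.
Qed.

Lemma PSL2Z_mul1g : left_id PSL2Z_one PSL2Z_mul.
Proof.
move=> x; rewrite -[RHS]reprK; apply/PSL2Z_eqP; rewrite -[X in word_eq _ X]cat0s.
by apply: word_eq_cat; [exact: PSL2Z_repr|exact: word_eq_refl].
Qed.

Lemma PSL2Z_mulg1 : right_id PSL2Z_one PSL2Z_mul.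
Proof.
move=> x; rewrite -[RHS]reprK; apply/PSL2Z_eqP; rewrite -[X in word_eq _ X]cats0.
by apply: word_eq_cat; [exact: word_eq_refl|exact: PSL2Z_repr].
Qed.

Lemma PSL2Z_mulVg : left_inverse PSL2Z_one PSL2Z_inv PSL2Z_mul.
Proof.
move=> x; apply/PSL2Z_eqP; apply: word_eq_trans (word_eq_Vmul (repr x)).
by apply: word_eq_cat; [exact: PSL2Z_repr|exact: word_eq_refl].
Qed.

Lemma PSL2Z_mulgV : right_inverse PSL2Z_one PSL2Z_inv PSL2Z_mul.
Proof.
move=> x; apply/PSL2Z_eqP; apply: word_eq_trans (word_eq_mulV (repr x)).
by apply: word_eq_cat; [exact: word_eq_refl|exact: PSL2Z_repr].
Qed.

HB.instance Definition _ := isGroup.Build PSL2Z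
  PSL2Z_mulA PSL2Z_mul1g PSL2Z_mulg1 PSL2Z_mulVg PSL2Z_mulgV.

Definition PSL2Z_gen (g : gen) : PSL2Z := \pi_PSL2Z%qT [:: (g, false)].

Section Lift.
Local Open Scope group_scope.
Variables (G : groupType) (g : gen -> G).

Definition eval_letter (l : letter) : G := if l.2 then (g l.1)^-1 else g l.1.
Definition eval_word (w : word) : G := \prod_(l <- w) eval_letter l.
Definition PSL2Z_lift (x : PSL2Z) : G := eval_word (repr x).

Hypotheses (g2 : g a2 * g a2 = 1) (g1 : g a1 * g a1 * g a1 = 1)
  (g0 : g a2 * g a1 = g a0).

Lemma eval_word_cat v w : eval_word (v ++ w) = eval_word v * eval_word w.
Proof. by rewrite /eval_word big_cat. Qed.

Lemma eval_word_eq v w : word_eq v w -> eval_word v = eval_word w.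
Proof.
elim=> {v w} [w|v w _ ->|w1 w2 w3 _ -> _ ->|v v' w w' _ vv _ ww|j s|||] //.
- by rewrite !eval_word_cat vv ww.
- rewrite /eval_word 2!big_cons big_nil mulg1 /eval_letter/=.
  by case: s; rewrite /= ?mulVg ?mulgV.
- by rewrite /eval_word 2!big_cons big_nil mulg1; exact: g2.
- by rewrite /eval_word 3!big_cons big_nil mulg1 mulgA; exact: g1.
- by rewrite /eval_word !big_cons !big_nil !mulg1; exact: g0.
Qed.

Lemma PSL2Z_liftM : {morph PSL2Z_lift : x y / x * y}.
Proof.
by move=> x y; rewrite /PSL2Z_lift -eval_word_cat; apply/eval_word_eq/PSL2Z_repr.
Qed.

Lemma PSL2Z_lift1 : PSL2Z_lift 1 = 1.
Proof. by rewrite /PSL2Z_lift (eval_word_eq (PSL2Z_repr [::])) /eval_word big_nil. Qed.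

Lemma PSL2Z_lift_gen j : PSL2Z_lift (PSL2Z_gen j) = g j.
Proof.
by rewrite /PSL2Z_lift (eval_word_eq (PSL2Z_repr _)) /eval_word big_seq1.
Qed.

End Lift.

Section PU31.
Variable R : realType.

HB.instance Definition _ := PseudoPointedMetric.copy R[i] R[i]^o.

Definition herm (z w : 'cV[R[i]]_4) : R[i] :=
  z 0 0 * (w 3 0)^*%C + z 1 0 * (w 1 0)^*%C + z 2 0 * (w 2 0)^*%C + z 3 0 * (w 0 0)^*%C.

Definition unitary31 : pred 'M[R[i]]_4 :=
  fun A => `[< forall z w, herm (A *m z) (A *m w) = herm z w >].

Definition mx4 (s : seq (seq R[i])) : 'M[R[i]]_4 :=
  \matrix_(i, j) nth 0 (nth [::] s i) j.

Definition expi (t : R) : R[i] := cos t +i* sin t.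

Definition M0 : 'M[R[i]]_4 := mx4
  [:: [:: 0; 0; 0; 1];
      [:: 0; 1; 0; 0];
      [:: 0; 0; 1; 0];
      [:: 1; 0; 0; 0]].

Definition M1 : 'M[R[i]]_4 := mx4
  [:: [:: 1;  0; 0; 0];
      [:: 0; -1; 0; 0];
      [:: 0;  0; 1; 0];
      [:: 0;  0; 0; 1]].

Definition U (beta : R) : 'M[R[i]]_4 := mx4
  [:: [:: 1; 0;             0;               0];
      [:: 0; (cos beta)%:C; - (sin beta)%:C; 0];
      [:: 0; (sin beta)%:C; (cos beta)%:C;   0];
      [:: 0; 0;             0;               1]].

Definition u (alpha : R) : R[i] :=
  'i%C * expi (- (alpha / 2)) * (Num.sqrt (2 * cos alpha))%:C.

Definition M2_0 (alpha : R) : 'M[R[i]]_4 := mx4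
  [:: [:: 1; u alpha;        0;                      - expi (- alpha)];
      [:: 0; expi (- alpha); 0;                      u alpha];
      [:: 0; 0;              - expi (- (alpha / 3)); 0];
      [:: 0; 0;              0;                      1]].

Definition M2 (alpha beta : R) : 'M[R[i]]_4 :=
  U beta *m M2_0 alpha *m invmx (U beta).

Definition conjmx (A : 'M[R[i]]_4) : 'M[R[i]]_4 := map_mx conjc A.

Lemma ord4E : (ord0 = 0 :> 'I_4) * (lift ord0 ord0 = 1 :> 'I_4) *
  (lift ord0 (lift ord0 ord0) = 2 :> 'I_4) *
  (lift ord0 (lift ord0 (lift ord0 ord0)) = 3 :> 'I_4).
Proof. by do !split; apply/val_inj. Qed.

Lemma hermE (z w : 'cV[R[i]]_4) :
  herm z w = (z^T *m M0 *m map_mx conjc w) 0 0.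
Proof.
rewrite !mxE !big_ord_recl big_ord0 /herm !mxE !big_ord_recl !big_ord0 !mxE /=.
rewrite !(mulr0, mulr1, add0r, addr0).
rewrite !ord4E; ring.
Qed.

Lemma unitary31P (A : 'M[R[i]]_4) :
  reflect (A^T *m M0 *m conjmx A = M0) (unitary31 A).
Proof.
apply: (iffP (asboolP _)) => [H|H z w].
  apply/matrixP => i j.
  have := H (delta_mx i 0) (delta_mx j 0); rewrite !hermE.
  rewrite !map_mxM /= -/(conjmx A) trmx_mul.
  have -> : map_mx conjc (delta_mx j 0) = delta_mx j 0 :> 'cV[R[i]]_4.
    exact: map_delta_mx.
  rewrite trmx_delta.
  have E (B : 'M[R[i]]_4) :
      (delta_mx (0 : 'I_1) i *m B *m (delta_mx j 0 : 'cV_4)) 0 0 = B i j.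
    by rewrite -rowE -colE !mxE.
  have EM := E M0; have EA := E (A^T *m M0 *m conjmx A).
  by rewrite !mulmxA in EA *; rewrite EA EM.
rewrite !hermE map_mxM /= -/(conjmx A) trmx_mul !mulmxA.
by rewrite -(mulmxA z^T) -(mulmxA z^T) H.
Qed.

Lemma M0_sqr : M0 *m M0 = 1%:M.
Proof.
apply/matrixP => i j; rewrite !mxE !big_ord_recl big_ord0 !mxE /=.
by case: i => [[|[|[|[|//]]]] ?]; case: j => [[|[|[|[|//]]]] ?] /=;
  rewrite ?(mulr0, mul0r, mulr1, addr0, add0r).
Qed.

Lemma unitary31_unitmx (A : 'M[R[i]]_4) : unitary31 A -> A \in unitmx.
Proof.
move=> /unitary31P H; have /mulmx1_unit [] // : (M0 *m A^T *m M0) *m conjmx A = 1%:M.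
  by rewrite -!mulmxA (mulmxA A^T) H M0_sqr.
move=> _; rewrite /conjmx !unitmxE det_map_mx !unitfE.
by apply: contra => /eqP ->; rewrite rmorph0.
Qed.

Lemma unitary31_1 : unitary31 1%:M.
Proof. by apply/asboolP => z w; rewrite !mul1mx. Qed.

Lemma unitary31_mul (A B : 'M[R[i]]_4) :
  unitary31 A -> unitary31 B -> unitary31 (A *m B).
Proof.
by move=> /asboolP hA /asboolP hB; apply/asboolP => z w; rewrite -!mulmxA hA hB.
Qed.

Lemma unitary31_inv (A : 'M[R[i]]_4) : unitary31 A -> unitary31 (invmx A).
Proof.
move=> hA; have uA := unitary31_unitmx hA; apply/asboolP => z w.
by move/asboolP: hA => <-; rewrite !mulKVmx.
Qed.

Lemma conjmxM (A B : 'M[R[i]]_4) : conjmx (A *m B) = conjmx A *m conjmx B.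
Proof. exact: map_mxM. Qed.

Lemma conjmxK : involutive conjmx.
Proof. by move=> A; apply/matrixP => i j; rewrite !mxE conjcK. Qed.

Lemma conjmx_M0 : conjmx M0 = M0.
Proof.
apply/matrixP => i j; rewrite !mxE.
by case: i => [[|[|[|[|//]]]] ?]; case: j => [[|[|[|[|//]]]] ?] /=;
  rewrite oppr0.
Qed.

Lemma unitary31_conj (A : 'M[R[i]]_4) : unitary31 A -> unitary31 (conjmx A).
Proof.
move=> /unitary31P /(congr1 conjmx); rewrite !conjmxM conjmx_M0 => H.
by apply/unitary31P; rewrite -[RHS]H {1}/conjmx map_trmx.
Qed.

(* The group U(3,1) of the Hermitian form. *)
Record U31 := MkU31 { U31_val :> 'M[R[i]]_4; U31_prop : unitary31 U31_val }.
HB.instance Definition _ := [isSub for U31_val].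
HB.instance Definition _ := [Choice of U31 by <:].
HB.instance Definition _ := Topological.copy U31 (initial_topology U31_val).

Definition U31_one := MkU31 unitary31_1.
Definition U31_mul (A B : U31) := MkU31 (unitary31_mul (U31_prop A) (U31_prop B)).
Definition U31_inv (A : U31) := MkU31 (unitary31_inv (U31_prop A)).

Lemma U31_mulA : associative U31_mul.
Proof. by move=> A B C; apply/val_inj; rewrite /= mulmxA. Qed.
Lemma U31_mul1g : left_id U31_one U31_mul.
Proof. by move=> A; apply/val_inj; rewrite /= mul1mx. Qed.
Lemma U31_mulg1 : right_id U31_one U31_mul.
Proof. by move=> A; apply/val_inj; rewrite /= mulmx1. Qed.
Lemma U31_mulVg : left_inverse U31_one U31_inv U31_mul.
Proof.
by move=> A; apply/val_inj; rewrite /= mulVmx// unitary31_unitmx// U31_prop.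
Qed.
Lemma U31_mulgV : right_inverse U31_one U31_inv U31_mul.
Proof.
by move=> A; apply/val_inj; rewrite /= mulmxV// unitary31_unitmx// U31_prop.
Qed.
HB.instance Definition _ := isGroup.Build U31
  U31_mulA U31_mul1g U31_mulg1 U31_mulVg U31_mulgV.

Definition proj_eq : rel U31 := fun A B =>
  `[< exists2 c : R[i], c != 0 & U31_val A = c *: U31_val B >].

Lemma proj_eq_refl : reflexive proj_eq.
Proof. by move=> A; apply/asboolP; exists 1; rewrite ?oner_neq0 ?scale1r. Qed.
Lemma proj_eq_sym : symmetric proj_eq.
Proof.
have h A B : proj_eq A B -> proj_eq B A.
  move=> /asboolP[c c0 E]; apply/asboolP; exists c^-1; first by rewrite invr_eq0.
  by rewrite E scalerA mulVf// scale1r.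
by move=> A B; apply/idP/idP; exact: h.
Qed.
Lemma proj_eq_trans : transitive proj_eq.
Proof.
move=> B A C /asboolP[c c0 E] /asboolP[d d0 F]; apply/asboolP; exists (c * d).
  by rewrite mulf_neq0.
by rewrite E F scalerA.
Qed.
Canonical proj_equiv := EquivRel proj_eq proj_eq_refl proj_eq_sym proj_eq_trans.

(* PU(3,1) = U(3,1) / U(1) with the quotient topology; a scalar relating two
   elements of U(3,1) automatically has modulus 1. *)
Definition PU31 := quotient_topology {eq_quot proj_equiv}%qT.
HB.instance Definition _ := Choice.on PU31.
HB.instance Definition _ := Quotient.on PU31.
HB.instance Definition _ := Topological.on PU31.

Definition PU31_class (A : U31) : PU31 := \pi_PU31%qT A.

Lemma PU31_eqP (A B : U31) : PU31_class A = PU31_class B <->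
  exists2 c : R[i], c != 0 & U31_val A = c *: U31_val B.
Proof.
split; first by move=> /(@eqmodP _ proj_equiv) /asboolP.
by move=> h; apply/(@eqmodP _ proj_equiv)/asboolP.
Qed.

Lemma PU31_reprK (x : PU31) : PU31_class (repr x) = x.
Proof. exact: reprK. Qed.

Definition PU31_one := PU31_class 1%g.
Definition PU31_mul (x y : PU31) := PU31_class (repr x * repr y)%g.
Definition PU31_inv (x : PU31) := PU31_class (repr x)^-1%g.

Lemma PU31_mul_class (A B : U31) :
  PU31_mul (PU31_class A) (PU31_class B) = PU31_class (A * B)%g.
Proof.
have /PU31_eqP[c c0 E] := PU31_reprK (PU31_class A).
have /PU31_eqP[d d0 F] := PU31_reprK (PU31_class B).
apply/PU31_eqP; exists (c * d); first by rewrite mulf_neq0.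
by rewrite /= E F -scalemxAl -scalemxAr scalerA.
Qed.

Lemma PU31_mulA : associative PU31_mul.
Proof.
move=> x y z; rewrite -(PU31_reprK x) -(PU31_reprK y) -(PU31_reprK z).
by rewrite !PU31_mul_class mulgA.
Qed.
Lemma PU31_mul1g : left_id PU31_one PU31_mul.
Proof. by move=> x; rewrite -(PU31_reprK x) PU31_mul_class mul1g. Qed.
Lemma PU31_mulg1 : right_id PU31_one PU31_mul.
Proof. by move=> x; rewrite -(PU31_reprK x) PU31_mul_class mulg1. Qed.
Lemma PU31_mulVg : left_inverse PU31_one PU31_inv PU31_mul.
Proof.
by move=> x; rewrite -{2}(PU31_reprK x) PU31_mul_class mulVg.
Qed.
Lemma PU31_mulgV : right_inverse PU31_one PU31_inv PU31_mul.
Proof.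
by move=> x; rewrite -{1}(PU31_reprK x) PU31_mul_class mulgV.
Qed.
HB.instance Definition _ := isGroup.Build PU31
  PU31_mulA PU31_mul1g PU31_mulg1 PU31_mulVg PU31_mulgV.

Lemma mx4_mul (s t : seq (seq R[i])) : mx4 s *m mx4 t =
  \matrix_(i, j) \sum_(k < 4) nth 0 (nth [::] s i) k * nth 0 (nth [::] t k) j.
Proof. by apply/matrixP => i j; rewrite !mxE; apply: eq_bigr => k _; rewrite !mxE. Qed.

Lemma mx4P (A B : 'M[R[i]]_4) :
  (forall i j : nat, forall (hi : (i < 4)%N) (hj : (j < 4)%N),
    A (Ordinal hi) (Ordinal hj) = B (Ordinal hi) (Ordinal hj)) -> A = B.
Proof. by move=> h; apply/matrixP => -[i hi] [j hj]. Qed.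

Ltac mx4_entries :=
  apply: mx4P; move=> [|[|[|[|?]]]] [|[|[|[|?]]]] // ? ?;
  rewrite !mxE ?big_ord_recl ?big_ord0 ?mxE
    ?big_ord_recl ?big_ord0 ?mxE /=.

Lemma expiD (s t : R) : expi (s + t) = expi s * expi t.
Proof. by rewrite /expi cosD sinD; apply/eqP; rewrite eq_complex /= eqxx addrC eqxx. Qed.

Lemma expiN (t : R) : expi (- t) = (expi t)^*%C.
Proof. by rewrite /expi cosN sinN. Qed.

Lemma expi_conjM (t : R) : expi t * (expi t)^*%C = 1.
Proof. by rewrite -expiN -expiD subrr /expi cos0 sin0. Qed.

Lemma expi_addconj (t : R) : expi t + (expi t)^*%C = (2 * cos t)%:C.
Proof. by rewrite /expi /=; apply/eqP; rewrite eq_complex /= subrr eqxx andbT mulr_natl mulr2n. Qed.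

Lemma conjc_real (x : R) : (x%:C)^*%C = x%:C.
Proof. by rewrite /= oppr0. Qed.

Lemma conjcM (x y : R[i]) : (x * y)^*%C = x^*%C * y^*%C.
Proof. exact: rmorphM. Qed.

Lemma conjc_i : ('i%C)^*%C = - 'i%C :> R[i].
Proof. by apply/eqP; rewrite eq_complex /= oppr0 !eqxx. Qed.

Lemma uE (alpha : R) : u alpha + expi (- alpha) * (u alpha)^*%C = 0.
Proof.
rewrite /u !conjcM conjc_real conjc_i.
have -> : expi (- alpha) = expi (- (alpha / 2)) * expi (- (alpha / 2)).
  by rewrite -expiD; congr expi; field.
have := expi_conjM (- (alpha / 2)).
set h := expi _ => hh.
set s := (Num.sqrt _)%:C.
rewrite -[X in _ + X](_ : - 'i%C * h * s * (h * h^*%C) = _); last by ring.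
by rewrite hh; ring.
Qed.

Lemma u_normE (alpha : R) : 0 <= cos alpha ->
  u alpha * (u alpha)^*%C = expi (- alpha) + expi alpha.
Proof.
move=> ca; have -> : expi alpha = (expi (- alpha))^*%C by rewrite -expiN opprK.
rewrite expi_addconj cosN.
rewrite /u !conjcM conjc_real conjc_i.
have := expi_conjM (- (alpha / 2)); set h := expi _ => hh.
have ii : 'i%C * 'i%C = -1 :> R[i].
  by apply/eqP; rewrite eq_complex /= !mulr0 !mul0r mulr1 addr0 sub0r oppr0 !eqxx.
set s := Num.sqrt _.
have ss : s%:C * s%:C = (2 * cos alpha)%:C :> R[i].
  by rewrite -rmorphM /= -expr2 sqr_sqrtr// mulr_ge0.
rewrite -ss.
transitivity (- ('i%C * 'i%C) * (h * h^*%C) * (s%:C * s%:C)); first by ring.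
by rewrite ii hh; ring.
Qed.

Lemma unitary31_M0 : unitary31 M0.
Proof.
apply/unitary31P; rewrite conjmx_M0 -mulmxA M0_sqr mulmx1.
by mx4_entries.
Qed.

Lemma unitary31_M1 : unitary31 M1.
Proof.
apply/asboolP => z w; rewrite /herm.
rewrite !(mxE, big_ord_recl, big_ord0) /= ?(mul0r, mul1r, add0r, addr0, mulN1r).
by rewrite ?rmorphN /= !ord4E; ring.
Qed.

Lemma conjmx_U (beta : R) : conjmx (U beta) = U beta.
Proof. by mx4_entries; apply/eqP; rewrite eq_complex /= ?oppr0 !eqxx. Qed.

Lemma U_trmx (beta : R) : U beta *m (U beta)^T = 1%:M.
Proof.
have cs : (cos beta)%:C * (cos beta)%:C + (sin beta)%:C * (sin beta)%:C = 1 :> R[i].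
  by rewrite -!rmorphM -rmorphD /= -!expr2 cos2Dsin2.
move: cs; rewrite /U; move: (cos beta)%:C (sin beta)%:C => c s cs.
by mx4_entries; rewrite ?(mul0r, mul1r, mulr0, add0r, addr0) //; rewrite -?cs; ring.
Qed.

Lemma M0_U (beta : R) : M0 *m U beta = U beta *m M0.
Proof.
rewrite /U; move: (cos beta)%:C (sin beta)%:C => c s.
transitivity (mx4
  [:: [:: 0; 0; 0; 1]; [:: 0; c; - s; 0]; [:: 0; s; c; 0]; [:: 1; 0; 0; 0]]).
  by mx4_entries; rewrite ?(mul0r, mul1r, mulr1, mulr0, add0r, addr0).
by mx4_entries; rewrite ?(mul0r, mul1r, mulr1, mulr0, add0r, addr0).
Qed.

Lemma unitary31_U (beta : R) : unitary31 (U beta).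
Proof.
apply/unitary31P; rewrite conjmx_U -mulmxA M0_U mulmxA.
by rewrite (mulmx1C (U_trmx beta)) mul1mx.
Qed.

Definition M2_0gen (e f v : R[i]) : 'M[R[i]]_4 := mx4
  [:: [:: 1; v; 0; - e]; [:: 0; e; 0; v]; [:: 0; 0; - f; 0]; [:: 0; 0; 0; 1]].

Lemma M2_0genE (alpha : R) :
  M2_0 alpha = M2_0gen (expi (- alpha)) (expi (- (alpha / 3))) (u alpha).
Proof. by []. Qed.

Lemma conjmx_M2_0gen (e f v : R[i]) :
  conjmx (M2_0gen e f v) = M2_0gen e^*%C f^*%C v^*%C.
Proof.
mx4_entries; rewrite ?oppr0 //; exact: rmorphN.
Qed.

Lemma eq_lin (a b c d : R[i]) : a = b -> c - d = a - b -> c = d.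
Proof. by move=> -> /eqP; rewrite subrr subr_eq0 => /eqP. Qed.

Lemma M2_0gen_form (e f v e' f' v' : R[i]) : e * e' = 1 -> f * f' = 1 ->
  v + e * v' = 0 -> v' + e' * v = 0 -> v * v' = e + e' ->
  (M2_0gen e f v)^T *m M0 *m M2_0gen e' f' v' = M0.
Proof.
move=> h1 h2 h3 h4 h5.
have -> : (M2_0gen e f v)^T *m M0 = mx4
  [:: [:: 0; 0; 0; 1]; [:: 0; e; 0; v]; [:: 0; 0; - f; 0]; [:: 1; v; 0; - e]].
  by mx4_entries; rewrite ?(mul0r, mul1r, mulr1, mulr0, add0r, addr0).
mx4_entries;
  rewrite ?(mul0r, mul1r, mulr1, mulr0, add0r, addr0) //;
  first [ring | apply: (eq_lin h1); ring | apply: (eq_lin h2); ring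
       | apply: (eq_lin h3); ring | apply: (eq_lin h4); ring
       | apply: (eq_lin h5); ring].
Qed.

Lemma unitary31_M2_0 (alpha : R) : 0 <= cos alpha -> unitary31 (M2_0 alpha).
Proof.
move=> ca; apply/unitary31P; rewrite M2_0genE conjmx_M2_0gen.
have h3 := uE alpha.
apply: M2_0gen_form; rewrite ?expi_conjM //.
- rewrite -[X in _ * X]conjcK -conjcM.
  by transitivity (0^*%C : R[i]); [rewrite -h3; exact/esym/rmorphD|exact: rmorph0].
- by rewrite u_normE// -expiN opprK.
Qed.

Lemma unitary31_M2 (alpha beta : R) :
  0 <= cos alpha -> unitary31 (M2 alpha beta).
Proof.
move=> ca; apply: unitary31_mul; last exact/unitary31_inv/unitary31_U.
by apply: unitary31_mul; [exact: unitary31_U|exact: unitary31_M2_0].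
Qed.

Lemma invmx_U (beta : R) : invmx (U beta) = (U beta)^T.
Proof.
have uU := unitary31_unitmx (unitary31_U beta).
by rewrite -[RHS](mulKmx uU) U_trmx mulmx1.
Qed.

Lemma conjmx_M2 (alpha beta : R) :
  conjmx (M2 alpha beta) = U beta *m conjmx (M2_0 alpha) *m invmx (U beta).
Proof.
rewrite /M2 !conjmxM invmx_U conjmx_U; congr (_ *m _).
by rewrite /conjmx -map_trmx -/(conjmx _) conjmx_U.
Qed.

Lemma M0_M2_0gen_cube (e f v : R[i]) : f ^+ 3 = e -> v ^+ 2 = - (e ^+ 2 + 1) ->
  let B := M0 *m M2_0gen e f v in B *m B *m B = (- e) *: 1%:M.
Proof.
move=> h1 h2 /=.
have -> : M0 *m M2_0gen e f v = mx4
  [:: [:: 0; 0; 0; 1]; [:: 0; e; 0; v]; [:: 0; 0; - f; 0]; [:: 1; v; 0; - e]].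
  by mx4_entries; rewrite ?(mul0r, mul1r, mulr1, mulr0, add0r, addr0).
set B := mx4 _.
have -> : B *m B = mx4
  [:: [:: 1; v; 0; - e]; [:: v; -1; 0; 0]; [:: 0; 0; f ^+ 2; 0]; [:: - e; 0; 0; 0]].
  mx4_entries; rewrite ?(mul0r, mul1r, mulr1, mulr0, add0r, addr0) //;
    first [ring | apply: (eq_lin h2); ring].
mx4_entries; rewrite ?(mul0r, mul1r, mulr1, mulr0, add0r, addr0) //;
  first [ring | apply: (eq_lin (esym h1)); ring | apply: (eq_lin h2); ring].
Qed.

Lemma conj_cube (P B : 'M[R[i]]_4) (c : R[i]) : P \in unitmx ->
  B *m B *m B = c *: 1%:M ->
  let C := P *m B *m invmx P in C *m C *m C = c *: 1%:M.
Proof.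
move=> uP H /=; rewrite -!mulmxA !(mulKmx uP).
have -> : B *m (B *m (B *m invmx P)) = B *m B *m B *m invmx P by rewrite !mulmxA.
by rewrite H -scalemxAl mul1mx -scalemxAr mulmxV.
Qed.

Lemma conjmx_M0M2_cube (alpha beta : R) : 0 <= cos alpha ->
  let B := M0 *m conjmx (M2 alpha beta) in
  B *m B *m B = (- expi alpha) *: 1%:M.
Proof.
move=> ca /=.
have uU := unitary31_unitmx (unitary31_U beta).
have -> : M0 *m conjmx (M2 alpha beta) =
    U beta *m (M0 *m conjmx (M2_0 alpha)) *m invmx (U beta).
  by rewrite conjmx_M2 !mulmxA M0_U.
rewrite M2_0genE conjmx_M2_0gen.
apply: conj_cube => //.
rewrite M0_M2_0gen_cube.
- by rewrite -expiN opprK.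
- by rewrite -!expiN !opprK exprS expr2 -!expiD; congr expi; field.
- have h1 := uE alpha; have h2 := u_normE ca.
  have h3 := expi_conjM (- alpha); rewrite -!expiN !opprK in h3 *.
  transitivity (- (expi alpha * (u alpha * (u alpha)^*%C))).
    have -> : (u alpha)^*%C = - (expi alpha * u alpha).
      transitivity (expi (- alpha) * expi alpha * (u alpha)^*%C).
        by rewrite h3 mul1r.
      by apply: (eq_lin (congr1 (fun t => expi alpha * t) h1)); rewrite /=; ring.
    by ring.
  by rewrite h2 mulrDr -expr2 addrC [expi alpha * expi (- alpha)]mulrC h3.
Qed.

Lemma M1_M0 : M1 *m M0 = M0 *m M1.
Proof.
transitivity (mx4
  [:: [:: 0; 0; 0; 1]; [:: 0; -1; 0; 0]; [:: 0; 0; 1; 0]; [:: 1; 0; 0; 0]]).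
  by mx4_entries; rewrite ?(mul0r, mul1r, mulr1, mulr0, add0r, addr0).
by mx4_entries; rewrite ?(mul0r, mul1r, mulr1, mulr0, add0r, addr0).
Qed.

Lemma M1_sqr : M1 *m M1 = 1%:M.
Proof.
by mx4_entries; rewrite ?(mul0r, mul1r, mulr1, mulr0, add0r, addr0) ?mulrNN ?mul1r.
Qed.

End PU31.

Section Representation.
Variable R : realType.

Definition square : set (R * R) :=
  `[0, pi / 2]%classic `*` `[0, pi / 2]%classic.

Lemma pihalf_in : pi / 2 \in `[(0 : R), pi / 2].
Proof. by rewrite in_itv /= lexx andbT divr_ge0 ?pi_ge0. Qed.

Definition square_pt (alpha beta : R) (ha : alpha \in `[0, pi / 2])
    (hb : beta \in `[0, pi / 2]) : square :=
  exist _ (alpha, beta) (mem_set (conj ha hb)).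

Lemma square_cos_ge0 (p : square) : 0 <= cos (\val p).1.
Proof.
case: p => -[a b] /= /set_mem [] /=; rewrite in_itv /= => /andP[a0 a1] _.
by apply: cos_ge0_pihalf; rewrite a1 andbT (le_trans _ a0)// oppr_le0 divr_ge0 ?pi_ge0.
Qed.

Section Rho.
Variable p : square.
Let alpha := (\val p).1.
Let beta := (\val p).2.

(* iota_j iota_k, with iota_j induced by z |-> M_j conj(z), is induced by
   M_j conj(M_k). *)
Definition anti_mul (A B : U31 R) : PU31 R :=
  PU31_class (MkU31 (unitary31_mul (U31_prop A) (unitary31_conj (U31_prop B)))).

Definition U0 : U31 R := MkU31 (@unitary31_M0 R).
Definition U1 : U31 R := MkU31 (@unitary31_M1 R).
Definition U2 : U31 R := MkU31 (unitary31_M2 beta (square_cos_ge0 p)).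

Definition A0 : PU31 R := anti_mul U1 U2.
Definition A1 : PU31 R := anti_mul U0 U2.
Definition A2 : PU31 R := anti_mul U1 U0.

Definition rho_gen (g : gen) : PU31 R :=
  match g with a0 => A0 | a1 => A1 | a2 => A2 end.

Lemma PU31_mulE (A B : U31 R) :
  (PU31_class A * PU31_class B)%g = PU31_class (A * B)%g.
Proof. exact: PU31_mul_class. Qed.

Lemma rho_a2 : (rho_gen a2 * rho_gen a2 = 1)%g.
Proof.
rewrite /= /A2 /anti_mul PU31_mulE; apply/PU31_eqP; exists 1; first exact: oner_neq0.
rewrite scale1r /= conjmx_M0.
by rewrite [X in X *m _]M1_M0 mulmxA -(mulmxA (M0 R)) M1_sqr mulmx1 M0_sqr.
Qed.

Lemma rho_a1 : (rho_gen a1 * rho_gen a1 * rho_gen a1 = 1)%g.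
Proof.
rewrite /= /A1 /anti_mul !PU31_mulE; apply/PU31_eqP; exists (- expi alpha).
  rewrite oppr_eq0; apply/eqP => e0; have := expi_conjM alpha.
  by rewrite e0 mul0r => /esym/eqP; rewrite oner_eq0.
exact: (conjmx_M0M2_cube beta (square_cos_ge0 p)).
Qed.

Lemma rho_a0 : (rho_gen a2 * rho_gen a1 = rho_gen a0)%g.
Proof.
rewrite /= /A2 /A1 /A0 /anti_mul !PU31_mulE; congr PU31_class; apply/val_inj.
by rewrite /= conjmx_M0 mulmxA -(mulmxA (M1 R)) M0_sqr mulmx1.
Qed.

Definition rho : PSL2Z -> PU31 R := PSL2Z_lift rho_gen.

HB.instance Definition _ := isMultiplicative.Build PSL2Z (PU31 R) rho
  (PSL2Z_liftM rho_a2 rho_a1 rho_a0).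
HB.instance Definition _ := Multiplicative_isUMagmaMorphism.Build
  PSL2Z (PU31 R) rho (PSL2Z_lift1 rho_a2 rho_a1 rho_a0).

Lemma rho_genE g : rho (PSL2Z_gen g) = rho_gen g.
Proof. exact: PSL2Z_lift_gen rho_a2 rho_a1 rho_a0 g. Qed.

End Rho.

End Representation.
Arguments square R : clear implicits.

Definition faithful (G H : groupType) (f : {multiplicative G -> H}) : Prop :=
  injective f.

(* The image is a discrete subset: each of its points is isolated in it. *)
Definition discrete_image (G : Type) (T : topologicalType) (f : G -> T) : Prop :=
  range f `<=` isolated (range f).

(* Main.v *)
Require Import Defs.
From mathcomp Require Import all_boot all_order all_algebra.
From mathcomp Require Import generic_quotient complex.
From mathcomp Require Import all_classical all_reals all_analysis.
From mathcomp Require Import ring lra.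

Set Implicit Arguments.
Unset Strict Implicit.
Unset Printing Implicit Defensive.

Import Order.TTheory GRing.Theory Num.Theory.
Import numFieldNormedType.Exports.

Local Open Scope classical_set_scope.
Local Open Scope ring_scope.

(** At alpha = pi / 2 the representation preserves the complex line spanned by
    e_0 and e_3, on which it is the modular group, and rotates the transverse
    coordinates v = (z_1, z_2).  With x = z_0 and y = - i z_3, the parabolic
    generator P = A_0 acts by x |-> x + y, and the involution S = A_2
    exchanges x and y up to factors of modulus 1.  The proof shows that the
    classical ping-pong of the positive monoid generated by P and L = S P^-1 S
    survives a small deformation, as a statement about cones of vectors in C^4.

    Every element of PSL(2,Z) is a product of a power of the element of order
    three, a word in P and L, and an optional S (PSL2Z_normal_form).  A word is
    a sequence of blocks P^n and L^n, that is of blocks P^n and P^-n separated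
    by S.  The key estimate is that, for all n >= 1 at once, P^n maps the cone
    Re (x conj(y)) >= 0, |x|^2 <= 4 |y|^2, |v|^2 <= |x|^2 + |y|^2 into the
    cone where Re (x conj(y)) >= |y|^2 / 2, |y|^2 <= 4 |x|^2 and
    |v|^2 <= |x|^2 + |y|^2 (par_orbit_cone), and symmetrically for P^-n; then S
    leads back to the incoming cone of the opposite sign (A2_cone).  The error
    committed on v is harmless because |x|^2 + |y|^2 grows by a definite factor
    at each block.

    Uniformity in n is where the excluded angle enters.  The map P is block
    triangular with diagonal blocks 1, a unitary 2 x 2 block B, and 1.  As
    long as 1 is not an eigenvalue of B, the map P is conjugate, by a matrix
    close to the identity when alpha is close to pi / 2, to the sum of B and a
    translation, so that the errors remain bounded under iteration.  At
    alpha = pi / 2 the determinant of 1 - B is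
    e^(i pi / 3) (1 + sqrt 3 cos (2 beta)), which is nonzero because
    beta differs from beta_0, and it stays away from zero nearby.

    Finally the base point e_0 - e_3, fixed by S up to sign and satisfying
    Re (x conj(y)) = 0, is moved by every nontrivial normal form other than S out
    of an explicit set defined by strict inequalities, and S itself is excluded by
    its vanishing corner entry.  These conditions define an open neighbourhood
    of the identity of PU(3,1) that meets the image only there and only for the
    trivial element, which gives discreteness and faithfulness together
    (rho_discrete_faithful). *)

(** * Squared moduli and the cones *)

Section SquaredModulus.
Local Open Scope complex_scope.
Variable R : realType.
Implicit Types (x y z : R[i]) (t : R).

(** The square of the modulus, as a real number. *)
Definition sqc x : R := complex.Re x ^+ 2 + complex.Im x ^+ 2.

Lemma sqc_ge0 x : 0 <= sqc x.
Proof. by rewrite addr_ge0 ?sqr_ge0. Qed.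

Lemma sqcM x y : sqc (x * y) = sqc x * sqc y.
Proof. by case: x y => [a b] [c d]; rewrite /sqc /=; ring. Qed.

Lemma sqcN x : sqc (- x) = sqc x.
Proof. by case: x => [a b]; rewrite /sqc /= !sqrrN. Qed.

Lemma sqc_real t : sqc t%:C = t ^+ 2.
Proof. by rewrite /sqc /= expr0n addr0. Qed.

Lemma sqc0 : sqc 0 = 0.
Proof. by rewrite sqc_real expr0n. Qed.

Lemma sqc1 : sqc 1 = 1.
Proof. by rewrite sqc_real expr1n. Qed.

Lemma sqc_conj x : sqc x^* = sqc x.
Proof. by case: x => x y; rewrite /sqc /= sqrrN. Qed.

Lemma sqc_expi t : sqc (expi t) = 1.
Proof. by rewrite /sqc /= cos2Dsin2. Qed.

Lemma sqc_eq0 x : sqc x = 0 -> x = 0.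
Proof.
case: x => a b; rewrite /sqc /= => /eqP.
by rewrite paddr_eq0 ?sqr_ge0// !sqrf_eq0 => /andP[/eqP-> /eqP->].
Qed.

Lemma sqc_gt0 x : x != 0 -> 0 < sqc x.
Proof.
by move=> x0; rewrite lt_def sqc_ge0 andbT; apply: contra x0 => /eqP/sqc_eq0/eqP.
Qed.

Lemma sqr_addr_le t (p q : R) : 0 < t ->
  (p + q) ^+ 2 <= (1 + t) * p ^+ 2 + (1 + t^-1) * q ^+ 2.
Proof.
move=> t0; rewrite -subr_ge0.
have -> : (1 + t) * p ^+ 2 + (1 + t^-1) * q ^+ 2 - (p + q) ^+ 2 =
    t^-1 * (t * p - q) ^+ 2 by field; rewrite gt_eqF.
by rewrite mulr_ge0 ?sqr_ge0// invr_ge0 ltW.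
Qed.

Lemma sqcD_le t x y : 0 < t ->
  sqc (x + y) <= (1 + t) * sqc x + (1 + t^-1) * sqc y.
Proof.
move=> t0; case: x y => [a b] [c d]; rewrite /sqc /=.
have := sqr_addr_le a c t0; have := sqr_addr_le b d t0.
by rewrite !mulrDr; lra.
Qed.

Lemma sqcD_le2 x y : sqc (x + y) <= 2 * sqc x + 2 * sqc y.
Proof. by have := @sqcD_le 1 x y ltr01; rewrite invr1. Qed.

Lemma sqc_rotation (c s : R) x y : c ^+ 2 + s ^+ 2 = 1 ->
  sqc (c%:C * x - s%:C * y) + sqc (s%:C * x + c%:C * y) = sqc x + sqc y.
Proof.
move=> cs; case: x y => [a b] [e d]; rewrite /sqc /= -[RHS]mul1r -cs; ring.
Qed.

End SquaredModulus.

Section Cones.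
Local Open Scope complex_scope.
Variable R : realType.
Implicit Types (z : 'cV[R[i]]_4) (e : R).

(** With x = z_0 and y = - i z_3 this is Re (x conj(y)).  At alpha = pi / 2 the
    parabolic generator is x |-> x + y, and wall z = 0 is the geodesic wall of
    the complex line z_1 = z_2 = 0 which the involution reverses. *)
Definition wall z : R := - complex.Im (z 0 0 * (z 3 0)^*).
(** The size of the two coordinates transverse to the complex line spanned by the
    cusps e_0 and e_3. *)
Definition transv z : R := sqc (z 1 0) + sqc (z 2 0).

(** For a sign e, the vectors ready to be moved by a power of the parabolic map
    of sign e: they lie on the side e of the wall, y is not dominated by x, and
    the transverse part is controlled. *)
Definition cone_in e z : Prop :=
  [/\ 0 <= e * wall z, sqc (z 0 0) <= 4 * sqc (z 3 0) &
      transv z <= sqc (z 0 0) + sqc (z 3 0)].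

(** The vectors obtained by such a move: on the side e of the wall by a definite amount,
    with x not dominated by y.  The involution exchanges the roles of x and y
    and reverses the wall, hence maps this cone to cone_in (- e). *)
Definition cone_out e z : Prop :=
  [/\ sqc (z 3 0) <= 2 * (e * wall z), sqc (z 3 0) <= 4 * sqc (z 0 0) &
      transv z <= sqc (z 0 0) + sqc (z 3 0)].

(** A perturbed translation x' = x + e n y + f, with x = x1 + i x2 and
    y = r - i p, maps the incoming cone to the outgoing one.  The factor 21 / 20
    allowed for the growth of the transverse size V is absorbed by the growth of
    |x|^2 + |y|^2, which is definite because n >= 1 and |x| <= 2 |y|. *)
Lemma translation_estimate e (n x1 x2 p r f1 f2 V V' : R) :
  e ^+ 2 = 1 -> 1 <= n ->
  0 <= e * (x1 * r - x2 * p) ->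
  x1 ^+ 2 + x2 ^+ 2 <= 4 * (p ^+ 2 + r ^+ 2) ->
  V <= x1 ^+ 2 + x2 ^+ 2 + (p ^+ 2 + r ^+ 2) ->
  100 * (f1 ^+ 2 + f2 ^+ 2) <= n ^+ 2 * (p ^+ 2 + r ^+ 2) ->
  V' <= 21 / 20 * V + 1 / 50 * (p ^+ 2 + r ^+ 2) ->
  let y1 := x1 + e * n * r + f1 in let y2 := x2 - e * n * p + f2 in
  [/\ p ^+ 2 + r ^+ 2 <= 2 * (e * (y1 * r - y2 * p)),
      p ^+ 2 + r ^+ 2 <= 4 * (y1 ^+ 2 + y2 ^+ 2) &
      V' <= y1 ^+ 2 + y2 ^+ 2 + (p ^+ 2 + r ^+ 2)].
Proof.
move=> e2 n1 q0 XY VS fY V'V y1 y2; have n0 : 0 < n by lra.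
set X := x1 ^+ 2 + x2 ^+ 2 in XY VS *.
set Y := p ^+ 2 + r ^+ 2 in XY VS fY V'V *.
set f := f1 ^+ 2 + f2 ^+ 2 in fY.
have n2 : 1 <= n ^+ 2 by rewrite exprn_ege1.
have X0 : 0 <= X by rewrite addr_ge0 ?sqr_ge0.
have Y0 : 0 <= Y by rewrite addr_ge0 ?sqr_ge0.
have nY : Y <= n ^+ 2 * Y by rewrite ler_peMl.
(* the slack of 1 / 10 comes from 100 |f|^2 <= n^2 |y|^2 and Cauchy-Schwarz *)
have dot : - (n * Y) <= 10 * (e * (f1 * r - f2 * p)).
  have h : 0 <= (10 * (e * f1) + n * r) ^+ 2 + (10 * (e * f2) - n * p) ^+ 2.
    by rewrite addr_ge0 ?sqr_ge0.
  have {}h : 0 <= 100 * f + 20 * (n * (e * (f1 * r - f2 * p))) + n ^+ 2 * Y.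
    have -> : 100 * f = e ^+ 2 * (100 * f) by rewrite e2 mul1r.
    rewrite (le_trans h)// le_eqVlt; apply/orP; left; apply/eqP.
    by rewrite /f /Y; ring.
  rewrite -(ler_pM2l n0); move: h fY; move: (f) => f' h fY.
  by rewrite expr2 -!mulrA in h fY *; lra.
have qE : e * (y1 * r - y2 * p) =
    e * (x1 * r - x2 * p) + e ^+ 2 * (n * Y) + e * (f1 * r - f2 * p).
  by rewrite /y1 /y2 /Y; ring.
(* |a + f|^2 >= (9/10) |a|^2 - 9 |f|^2 for the unperturbed image a *)
have y2E : 9 / 10 * (X + 2 * (n * (e * (x1 * r - x2 * p))) + e ^+ 2 * (n ^+ 2 * Y))
    <= y1 ^+ 2 + y2 ^+ 2 + 9 * f.
  rewrite -subr_ge0.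
  have -> : y1 ^+ 2 + y2 ^+ 2 + 9 * f -
      9 / 10 * (X + 2 * (n * (e * (x1 * r - x2 * p))) + e ^+ 2 * (n ^+ 2 * Y)) =
      1 / 10 * ((x1 + e * n * r + 10 * f1) ^+ 2 + (x2 - e * n * p + 10 * f2) ^+ 2).
    by rewrite /y1 /y2 /Y /X /f; field.
  by rewrite mulr_ge0 ?addr_ge0 ?sqr_ge0// divr_ge0.
have nq : 0 <= n * (e * (x1 * r - x2 * p)) by rewrite mulr_ge0// ltW.
rewrite e2 !mul1r in qE y2E.
have nY1 : Y <= n * Y by rewrite ler_peMl.
by split; lra.
Qed.
End Cones.

(** * Powers of a screw parabolic map *)

Section ScrewParabolic.
Local Open Scope complex_scope.
Variable R : realType.
Variables (a b w : R[i]) (c s : R).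
Hypotheses (a1 : sqc a = 1) (b1 : sqc b = 1) (cs : c ^+ 2 + s ^+ 2 = 1).
Implicit Types z : 'cV[R[i]]_4.

(** The determinant of 1 - B, where B = diag(-1, 1) Rot diag(a, b) Rot^-1 is the
    transverse block of par_rel and Rot the rotation of matrix
    ((c, - s), (s, c)). *)
Definition par_det : R[i] := 1 + (a - b) * (c ^+ 2 - s ^+ 2)%:C - a * b.

(** z' is the image of z by the block triangular map with diagonal blocks 1, B
    and 1 and with off-diagonal entries of size w; at (alpha, beta) it is the
    parabolic generator, with a = e^(i alpha), b = - e^(i alpha / 3),
    w = conj(u alpha), c = cos beta and s = sin beta. *)
Definition par_rel z z' : Prop :=
  [/\ z' 0 0 = z 0 0 + w * (c%:C * z 1 0 + s%:C * z 2 0) - a * z 3 0,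
      z' 1 0 = - (c%:C * (a * (c%:C * z 1 0 + s%:C * z 2 0)) -
                  s%:C * (b * (c%:C * z 2 0 - s%:C * z 1 0))) - w * c%:C * z 3 0,
      z' 2 0 = s%:C * (a * (c%:C * z 1 0 + s%:C * z 2 0)) +
               c%:C * (b * (c%:C * z 2 0 - s%:C * z 1 0)) + w * s%:C * z 3 0 &
      z' 3 0 = z 3 0].

(* Since 1 - B is invertible, the map is conjugate to the direct sum of B and a
   translation: k solves (1 - B) k = w (- c, s), l solves
   l (1 - B) = w (c, s), and T and X are the resulting coordinates. *)
Let k1 := w / par_det * (c%:C * (b - 1)).
Let k2 := w / par_det * (s%:C * (1 + b)).
Let l1 := w / par_det * (c%:C * (1 - b)).
Let l2 := k2.
Let sigma := w * (c%:C * k1 + s%:C * k2) - a.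

Let T1 z := z 1 0 - k1 * z 3 0.
Let T2 z := z 2 0 - k2 * z 3 0.
Let N z := sqc (T1 z) + sqc (T2 z).
Let X z := z 0 0 + l1 * T1 z + l2 * T2 z.

(** In the diagonalizing coordinates (X, T, z_3), z' differs from z by a
    norm-preserving motion of T and the translation of X by n sigma z_3.  This holds
    when z' is the image of z by the n-th power of the map. *)
Definition par_orbit (n : R) z z' : Prop :=
  [/\ N z' = N z, X z' = X z + n%:C * sigma * z 3 0 & z' 3 0 = z 3 0].

Lemma par_orbitD m n z z' z'' :
  par_orbit m z z' -> par_orbit n z' z'' -> par_orbit (m + n) z z''.
Proof.
move=> [N1 X1 E1] [N2 X2 E2]; split; rewrite ?N2 ?E2 ?X2 ?X1 ?E1 // rmorphD.
by rewrite -addrA -!mulrDl.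
Qed.

Lemma par_orbitN n z z' : par_orbit n z z' -> par_orbit (- n) z' z.
Proof.
by case=> N1 X1 E1; split=> //; rewrite X1 E1 rmorphN !mulNr addrK.
Qed.

Hypothesis D0 : par_det != 0.

Let csC : c%:C ^+ 2 + s%:C ^+ 2 = 1 :> R[i].
Proof. by rewrite -!rmorphXn -rmorphD /= cs. Qed.

Lemma par_rel_orbit z z' : par_rel z z' -> par_orbit 1 z z'.
Proof.
case=> E0 E1 E2 E3.
set g := w / par_det.
have wE : w = g * (1 + (a - b) * (c%:C ^+ 2 - s%:C ^+ 2) - a * b).
  by rewrite -[LHS](divfK D0) -/g -!rmorphXn -rmorphB.
have cs0 : c%:C ^+ 2 + s%:C ^+ 2 - 1 = 0 :> R[i] by rewrite csC subrr.
(* identities are checked modulo c^2 + s^2 - 1, with an explicit cofactor *)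
have eq_mod (x y q : R[i]) : x - y = q * (c%:C ^+ 2 + s%:C ^+ 2 - 1) -> x = y.
  by rewrite cs0 mulr0 => /eqP; rewrite subr_eq0 => /eqP.
have T1E : T1 z' = - (c%:C * (a * (c%:C * T1 z + s%:C * T2 z)) -
                  s%:C * (b * (c%:C * T2 z - s%:C * T1 z))).
  rewrite /T1 /T2 E1 E3 /k1 /k2 -/g.
  by apply: (@eq_mod _ _ (g * c%:C * z 3 0 * b * (1 - a))); rewrite wE; ring.
have T2E : T2 z' = s%:C * (a * (c%:C * T1 z + s%:C * T2 z)) +
                  c%:C * (b * (c%:C * T2 z - s%:C * T1 z)).
  rewrite /T1 /T2 E2 E3 /k1 /k2 -/g.
  by apply: (@eq_mod _ _ (g * s%:C * z 3 0 * b * (1 + a))); rewrite wE; ring.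
split=> //.
  rewrite /N T1E T2E sqcN sqc_rotation// (sqcM a) (sqcM b) a1 b1 !mul1r.
  by rewrite [RHS]addrC -(sqc_rotation (T2 z) (T1 z) cs) addrC (addrC (s%:C * _)).
have -> : X z' = z 0 0 + w * (c%:C * T1 z + s%:C * T2 z) +
    l1 * T1 z' + l2 * T2 z' + sigma * z 3 0.
  by rewrite /X E0 /sigma /T1 /T2; ring.
rewrite mul1r /X T1E T2E /l1 /l2 /k2 -/g.
apply: (@eq_mod _ _ (g * (a * b * (c%:C * T1 z + s%:C * T2 z) -
  b * (c%:C * T1 z - s%:C * T2 z)))).
by rewrite wE; ring.
Qed.

Hypotheses (wD : 400 * (400 * sqc w) <= sqc par_det) (w1 : sqc w <= 1)
  (ai : 100 * (50 * sqc ('i - a)) <= 1).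

Let c2_le1 : c ^+ 2 <= 1.
Proof. by rewrite -cs lerDl sqr_ge0. Qed.
Let s2_le1 : s ^+ 2 <= 1.
Proof. by rewrite -cs lerDr sqr_ge0. Qed.

Let small (t : R) x y : t ^+ 2 <= 1 -> sqc x = 1 -> sqc y = 1 ->
  100 * (400 * sqc (w / par_det * (t%:C * (x + y)))) <= 1.
Proof.
move=> t1 x1 y1.
have wDi : sqc (w / par_det) * sqc par_det = sqc w by rewrite -sqcM divfK.
have D2 := sqc_gt0 D0.
have g0 : 400 * (400 * sqc (w / par_det)) <= 1.
  by rewrite -(ler_pM2r D2) mul1r -!mulrA wDi.
rewrite sqcM (sqcM t%:C).
rewrite sqc_real.
have xy : sqc (x + y) <= 4 by have := sqcD_le2 x y; rewrite x1 y1; lra.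
have h : t ^+ 2 * sqc (x + y) <= 1 * 4.
  by apply: ler_pM => //; rewrite ?sqr_ge0 ?sqc_ge0.
have ts0 : 0 <= t ^+ 2 * sqc (x + y) by rewrite mulr_ge0 ?sqr_ge0 ?sqc_ge0.
have := ler_pM (sqc_ge0 (w / par_det)) ts0 (lexx _) h.
by lra.
Qed.

Let k1_small : 100 * (400 * sqc k1) <= 1.
Proof. by apply: small; rewrite ?sqcN ?sqc1. Qed.
Let k2_small : 100 * (400 * sqc k2) <= 1.
Proof. by apply: small; rewrite ?sqc1. Qed.
Let l1_small : 100 * (400 * sqc l1) <= 1.
Proof. by apply: small; rewrite ?sqcN ?sqc1. Qed.

Let sigma_near : 1000 * sqc (sigma + 'i) <= 1.
Proof.
have -> : sigma + 'i = w * (c%:C * k1 + s%:C * k2) + ('i - a).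
  by rewrite /sigma; ring.
have := sqcD_le2 (w * (c%:C * k1 + s%:C * k2)) ('i - a).
have := sqcD_le2 (c%:C * k1) (s%:C * k2).
rewrite !(sqcM c%:C) !(sqcM s%:C) !sqc_real (sqcM w).
have := ler_pM (sqr_ge0 c) (sqc_ge0 k1) c2_le1 (lexx _).
have := ler_pM (sqr_ge0 s) (sqc_ge0 k2) s2_le1 (lexx _).
have := ler_pM (sqc_ge0 w) (sqc_ge0 (c%:C * k1 + s%:C * k2)) w1 (lexx _).
by move: k1_small k2_small ai; lra.
Qed.

Let mul_small (k x : R[i]) : 100 * (400 * sqc k) <= 1 ->
  100 * (400 * (sqc k * sqc x)) <= sqc x.
Proof. by move=> h; have := ler_wpM2r (sqc_ge0 x) h; rewrite mul1r -!mulrA. Qed.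

Let sqc_split (x y : R[i]) : sqc (x + y) <= 51 / 50 * sqc x + 51 * sqc y.
Proof.
have t0 : 0 < 1 / 50 :> R by lra.
by have := sqcD_le x y t0; rewrite div1r invrK; lra.
Qed.

Let sqc_lT (u v : R[i]) :
  100 * (100 * sqc (l1 * u + l2 * v)) <= sqc u + sqc v.
Proof.
have := sqcD_le2 (l1 * u) (l2 * v); rewrite (sqcM l1) (sqcM l2).
have := mul_small u l1_small; have := mul_small v k2_small.
by have := sqc_ge0 u; have := sqc_ge0 v; rewrite /l2; lra.
Qed.

(** Uniformly in n >= 1, the power e n of the map is an n-fold translation up to
    a small relative error: the correction terms l.T are bounded independently
    of n because the norm of T is constant. *)
Lemma par_orbit_cone (e n : R) z z' : e ^+ 2 = 1 -> 1 <= n ->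
  par_orbit (e * n) z z' -> cone_in e z -> cone_out e z'.
Proof.
move=> e2 n1 [N1 X1 E3] [q0 xy v].
set Y := sqc (z 3 0) in xy v *.
have Y0 : 0 <= Y := sqc_ge0 _.
have nY : Y <= n ^+ 2 * Y by rewrite ler_peMl// exprn_ege1.
have k1Y := mul_small (z 3 0) k1_small; have k2Y := mul_small (z 3 0) k2_small.
rewrite -/Y in k1Y k2Y.
have NT : N z <= 51 / 50 * transv z + 1 / 200 * Y.
  have := sqc_split (z 1 0) (- (k1 * z 3 0)).
  have := sqc_split (z 2 0) (- (k2 * z 3 0)).
  by rewrite /N /T1 /T2 /transv !sqcN (sqcM k1) (sqcM k2) -/Y; lra.
have NT' : transv z' <= 51 / 50 * N z + 1 / 200 * Y.
  rewrite -N1; have := sqc_split (T1 z') (k1 * z' 3 0).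
  have := sqc_split (T2 z') (k2 * z' 3 0).
  have -> : T1 z' + k1 * z' 3 0 = z' 1 0 by rewrite subrK.
  have -> : T2 z' + k2 * z' 3 0 = z' 2 0 by rewrite subrK.
  by rewrite /N /transv (sqcM k1) (sqcM k2) E3 -/Y; lra.
(* deviation of z'_0 from the exact translation by - i e n z_3 *)
set F := (e * n)%:C * (sigma + 'i) * z 3 0 +
  ((l1 * T1 z + l2 * T2 z) + - (l1 * T1 z' + l2 * T2 z')).
have FE : z' 0 0 = z 0 0 - (e * n)%:C * 'i * z 3 0 + F.
  have -> : z' 0 0 = X z' - (l1 * T1 z' + l2 * T2 z') by rewrite /X; ring.
  by rewrite X1 /F /X; ring.
have Fs : 100 * sqc F <= n ^+ 2 * Y.
  have := sqcD_le2 ((e * n)%:C * (sigma + 'i) * z 3 0)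
    ((l1 * T1 z + l2 * T2 z) + - (l1 * T1 z' + l2 * T2 z')).
  have := sqcD_le2 (l1 * T1 z + l2 * T2 z) (- (l1 * T1 z' + l2 * T2 z')).
  rewrite sqcN -/F.
  have := sqc_lT (T1 z) (T2 z); have := sqc_lT (T1 z') (T2 z').
  rewrite -/(N z) -/(N z') N1.
  have -> : sqc ((e * n)%:C * (sigma + 'i) * z 3 0) =
      n ^+ 2 * Y * sqc (sigma + 'i).
    by rewrite !sqcM -/Y sqc_real exprMn e2; ring.
  have : 1000 * (n ^+ 2 * Y * sqc (sigma + 'i)) <= n ^+ 2 * Y.
    by rewrite mulrCA ler_piMr// mulr_ge0 ?sqr_ge0.
  by lra.
have V' : transv z' <= 21 / 20 * transv z + 1 / 50 * Y.
  have : 0 <= transv z := addr_ge0 (sqc_ge0 _) (sqc_ge0 _).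
  by move: NT NT' Y0; lra.
rewrite /cone_out /wall E3; move: FE Fs q0 xy v V'; rewrite /wall /Y.
move: (z 0 0) (z 3 0) (z' 0 0) F (transv z) (transv z').
move=> [x1 x2] [p r] [y1 y2] [f1 f2] V V'.
rewrite /sqc /= => -[-> ->] fs q0 xy v v'.
have [] := @translation_estimate R e n x1 x2 p r f1 f2 V V' e2 n1 _ xy v fs v'.
  by move: q0; lra.
have -> : x1 - ((e * n * 0 - 0 * 1) * p - (e * n * 1 + 0 * 0) * r) + f1 =
  x1 + e * n * r + f1 by ring.
have -> : x2 - ((e * n * 0 - 0 * 1) * r + (e * n * 1 + 0 * 0) * p) + f2 =
  x2 - e * n * p + f2 by ring.
by move=> h1 h2 h3; split=> //; move: h1; lra.
Qed.
End ScrewParabolic.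

(** * The generators as matrices acting on vectors *)

Section Matrices.
Local Open Scope complex_scope.
Variable R : realType.
Implicit Types z : 'cV[R[i]]_4.

Lemma mx4_mulv (t : seq (seq R[i])) z (i : 'I_4) :
  (mx4 t *m z) i 0 =
    nth 0 (nth [::] t i) 0 * z 0 0 + nth 0 (nth [::] t i) 1 * z 1 0 +
    nth 0 (nth [::] t i) 2 * z 2 0 + nth 0 (nth [::] t i) 3 * z 3 0.
Proof.
by rewrite !mxE !big_ord_recl big_ord0 !mxE !ord4E /= addr0 !addrA.
Qed.

Lemma trmx_U (beta : R) : (U beta)^T = U (- beta).
Proof.
apply: mx4P; move=> [|[|[|[|?]]]] [|[|[|[|?]]]] // ? ?.
all: by rewrite !mxE //= ?cosN ?sinN ?rmorphN ?opprK.
Qed.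

Ltac mulv_entries :=
  split; rewrite mx4_mulv /= ?mul0r ?mul1r ?mulN1r ?add0r ?addr0.

Lemma U_mulv (beta : R) z :
  [/\ (U beta *m z) 0 0 = z 0 0,
      (U beta *m z) 1 0 = (cos beta)%:C * z 1 0 + - (sin beta)%:C * z 2 0,
      (U beta *m z) 2 0 = (sin beta)%:C * z 1 0 + (cos beta)%:C * z 2 0 &
      (U beta *m z) 3 0 = z 3 0].
Proof. by mulv_entries. Qed.

Lemma M2_0gen_mulv (e f v : R[i]) z :
  [/\ (M2_0gen e f v *m z) 0 0 = z 0 0 + v * z 1 0 + - e * z 3 0,
      (M2_0gen e f v *m z) 1 0 = e * z 1 0 + v * z 3 0,
      (M2_0gen e f v *m z) 2 0 = - f * z 2 0 &
      (M2_0gen e f v *m z) 3 0 = z 3 0].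
Proof. by mulv_entries. Qed.

Lemma M1_mulv z :
  [/\ (M1 R *m z) 0 0 = z 0 0, (M1 R *m z) 1 0 = - z 1 0,
      (M1 R *m z) 2 0 = z 2 0 & (M1 R *m z) 3 0 = z 3 0].
Proof. by mulv_entries. Qed.

Lemma M0_mulv z :
  [/\ (M0 R *m z) 0 0 = z 3 0, (M0 R *m z) 1 0 = z 1 0,
      (M0 R *m z) 2 0 = z 2 0 & (M0 R *m z) 3 0 = z 0 0].
Proof. by mulv_entries. Qed.

Lemma A0_par_rel (alpha beta : R) z :
  par_rel (expi alpha) (- expi (alpha / 3)) (u alpha)^* (cos beta) (sin beta) z
    (M1 R *m Defs.conjmx (M2 alpha beta) *m z).
Proof.
rewrite conjmx_M2 invmx_U trmx_U M2_0genE conjmx_M2_0gen -!expiN !opprK -!mulmxA.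
have sN : (- sin beta)%:C = - (sin beta)%:C :> R[i] by exact: rmorphN.
have [] := U_mulv (- beta) z; rewrite cosN sinN sN opprK.
set z1 := U _ *m z; clearbody z1 => e0 e1 e2 e3.
have [] := M2_0gen_mulv (expi alpha) (expi (alpha / 3)) (u alpha)^* z1.
set z2 := M2_0gen _ _ _ *m z1; clearbody z2.
rewrite {}e0 {}e1 {}e2 {}e3 => e0 e1 e2 e3.
have [] := U_mulv beta z2.
set z3 := U _ *m z2; clearbody z3.
rewrite {}e0 {}e1 {}e2 {}e3 => e0 e1 e2 e3.
have [] := M1_mulv z3; rewrite {}e0 {}e1 {}e2 {}e3 => e0 e1 e2 e3.
split; rewrite ?e0 ?e1 ?e2 ?e3 //.
all: move: (z 0 0) (z 1 0) (z 2 0) (z 3 0) (cos beta)%:C (sin beta)%:C.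
all: by move: (expi alpha) (expi (alpha / 3)) (u alpha)^* => *; ring.
Qed.

Lemma A2_mulv z :
  [/\ (M1 R *m M0 R *m z) 0 0 = z 3 0, (M1 R *m M0 R *m z) 1 0 = - z 1 0,
      (M1 R *m M0 R *m z) 2 0 = z 2 0 & (M1 R *m M0 R *m z) 3 0 = z 0 0].
Proof.
by rewrite -mulmxA; have [<- <- <- <-] := M0_mulv z; exact: M1_mulv.
Qed.

Lemma A2_cone e z : cone_out e z -> cone_in (- e) (M1 R *m M0 R *m z).
Proof.
have [E0 E1 E2 E3] := A2_mulv z.
rewrite /cone_out /cone_in /transv /wall E0 E1 E2 E3 sqcN => -[q h v].
have -> : complex.Im (z 3 0 * (z 0 0)^*) = - complex.Im (z 0 0 * (z 3 0)^*).
  by move: (z 0 0) (z 3 0) => [p r] [p' r'] /=; ring.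
split=> //; last by rewrite [leRHS]addrC.
by have := sqc_ge0 (z 3 0); lra.
Qed.

End Matrices.

(** * Continuity *)

Section Continuity.
Local Open Scope complex_scope.
Variable R : realType.

Lemma Re_continuous : continuous (@complex.Re R).
Proof.
move=> x A /nbhs_ballP[e /= e0 eA]; apply/nbhs_ballP.
exists e%:C; first by rewrite /= ltcR.
move=> y xy; have {}xy : `|x - y| < e%:C by exact: xy.
apply: eA; rewrite /ball /= -ltcR; apply: le_lt_trans xy.
by have := normc_ge_Re (x - y); move: x y => [? ?] [? ?].
Qed.

Lemma Im_continuous : continuous (@complex.Im R).
Proof.
move=> x A /nbhs_ballP[e /= e0 eA]; apply/nbhs_ballP.
exists e%:C; first by rewrite /= ltcR.
move=> y xy; have {}xy : `|x - y| < e%:C by exact: xy.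
apply: eA; rewrite /ball /= -ltcR; apply: le_lt_trans xy.
have i1 : `|'i%C : R[i]| = 1 by rewrite normc_def /= expr0n add0r expr1n sqrtr1.
have := normc_ge_Re ((x - y) * 'i); rewrite normrM i1 mulr1 ReiNIm normrN.
by move: x y => [? ?] [? ?].
Qed.

Variable T : topologicalType.
Implicit Types f g : T -> R[i].

(** Continuity of a complex-valued function through its two real components. *)
Definition ccontinuous f :=
  continuous (fun t => complex.Re (f t)) /\ continuous (fun t => complex.Im (f t)).

Lemma ccontinuous_cst (x : R[i]) : ccontinuous (fun=> x).
Proof. by split=> t; exact: cvg_cst. Qed.

Lemma ccontinuousD f g :
  ccontinuous f -> ccontinuous g -> ccontinuous (fun t => f t + g t).
Proof.
have ReD (x y : R[i]) : complex.Re (x + y) = complex.Re x + complex.Re y by case: x y => ? ? [].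
have ImD (x y : R[i]) : complex.Im (x + y) = complex.Im x + complex.Im y by case: x y => ? ? [].
move=> [f1 f2] [g1 g2]; split=> t.
- by under eq_fun do rewrite ReD; apply: cvgD; [exact: f1|exact: g1].
- by under eq_fun do rewrite ImD; apply: cvgD; [exact: f2|exact: g2].
Qed.

Lemma ccontinuousM f g :
  ccontinuous f -> ccontinuous g -> ccontinuous (fun t => f t * g t).
Proof.
have ReM (x y : R[i]) : complex.Re (x * y) =
    complex.Re x * complex.Re y - complex.Im x * complex.Im y by case: x y => ? ? [].
have ImM (x y : R[i]) : complex.Im (x * y) =
    complex.Re x * complex.Im y + complex.Im x * complex.Re y by case: x y => ? ? [].
move=> [f1 f2] [g1 g2]; split=> t.
- under eq_fun do rewrite ReM; apply: cvgB; apply: cvgM;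
    [exact: f1|exact: g1|exact: f2|exact: g2].
- under eq_fun do rewrite ImM; apply: cvgD; apply: cvgM;
    [exact: f1|exact: g2|exact: f2|exact: g1].
Qed.

Lemma ccontinuous_conj f : ccontinuous f -> ccontinuous (fun t => (f t)^*).
Proof.
have ReC (x : R[i]) : complex.Re x^* = complex.Re x by case: x.
have ImC (x : R[i]) : complex.Im x^* = - complex.Im x by case: x.
move=> [f1 f2]; split=> t.
- by under eq_fun do rewrite ReC; exact: f1.
- by under eq_fun do rewrite ImC; apply: cvgN; exact: f2.
Qed.

Lemma ccontinuous_sum (I : Type) (r : seq I) (F : I -> T -> R[i]) :
  (forall i, ccontinuous (F i)) -> ccontinuous (fun t => \sum_(i <- r) F i t).
Proof.
move=> Fc; elim: r => [|i r IH].
  by under eq_fun do rewrite big_nil; exact: ccontinuous_cst.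
by under eq_fun do rewrite big_cons; exact: ccontinuousD.
Qed.

Lemma continuous_sqc f : ccontinuous f -> continuous (fun t => sqc (f t)).
Proof.
move=> [f1 f2] t; rewrite /sqc.
apply: cvgD; under eq_fun do rewrite expr2; apply: cvgM; first
  [exact: f1|exact: f2].
Qed.

Lemma continuous_wall (F : T -> 'cV[R[i]]_4) :
  (forall i, ccontinuous (fun t => F t i 0)) -> continuous (fun t => wall (F t)).
Proof.
move=> Fc t; apply: cvgN.
by have [_ h] := ccontinuousM (Fc 0) (ccontinuous_conj (Fc 3)); exact: h.
Qed.

Lemma open_pos (f : T -> R) : continuous f -> open [set t | 0 < f t].
Proof.
move=> fc; apply: (@open_comp _ _ f [set x | 0 < x]); last exact: open_gt.
by move=> ? _; exact: fc.
Qed.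

Lemma continuous_sub2 (f g : T -> R) :
  continuous f -> continuous g -> continuous (fun t => f t - 2 * g t).
Proof.
move=> fc gc t; apply: cvgB; first exact: fc.
by apply: cvgM; [exact: cvg_cst|exact: gc].
Qed.

Lemma continuous_opp (f : T -> R) : continuous f -> continuous (fun t => - f t).
Proof. by move=> fc t; apply: cvgN; exact: fc. Qed.

End Continuity.

Section U31Topology.
Local Open Scope complex_scope.
Variable R : realType.

Lemma U31_entry_continuous (i j : 'I_4) :
  ccontinuous (fun h : U31 R => U31_val h i j).
Proof.
have c : continuous (fun h : U31 R => U31_val h i j).
  move=> h; apply: (@continuous_comp _ _ _ (@U31_val R) (fun M : 'M[R[i]]_4 => M i j)).
    exact: initial_continuous.
  exact: coord_continuous.
split=> h.
  apply: (@continuous_comp _ _ _ (fun h : U31 R => U31_val h i j)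
    (@complex.Re R)); [exact: c|exact: Re_continuous].
apply: (@continuous_comp _ _ _ (fun h : U31 R => U31_val h i j)
  (@complex.Im R)); [exact: c|exact: Im_continuous].
Qed.

Lemma U31_orbit_continuous (B : 'M[R[i]]_4) (z : 'cV[R[i]]_4) (i : 'I_4) :
  ccontinuous (fun h : U31 R => (B *m (U31_val h *m z)) i 0).
Proof.
under eq_fun do rewrite mxE.
apply: ccontinuous_sum => j; apply: ccontinuousM; first exact: ccontinuous_cst.
under eq_fun do rewrite mxE.
apply: ccontinuous_sum => k; apply: ccontinuousM; last exact: ccontinuous_cst.
exact: U31_entry_continuous.
Qed.

End U31Topology.

(** * Normal form in the modular group *)

Section NormalForm.
Local Open Scope group_scope.

(** The element of the monoid generated by p and s p^-1 s spelled by m: true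
    stands for p and false for its mirror image s p^-1 s. *)
Definition parabolic_word (G : groupType) (s p : G) (m : seq bool) : G :=
  foldr (fun b g => (if b then p else s * p^-1 * s) * g) 1 m.

(** The three powers 1, s p and (s p)^-1 of the element of order three. *)
Definition corner (G : groupType) (s p : G) (o : option bool) : G :=
  match o with None => 1 | Some true => s * p | Some false => (s * p)^-1 end.

(** An element of order dividing 3, times a positive word in the two parabolics,
    times an optional involution.  Every element of the modular group has this
    form; uniqueness is not needed. *)
Definition normal_form (G : groupType) (s p : G) (o : option bool) (m : seq bool) (b : bool) : G :=
  corner s p o * parabolic_word s p m * (if b then s else 1).

Section Closure.
Variables (G : groupType) (s p : G).
Hypotheses (s2 : s * s = 1) (sp3 : s * p * (s * p) * (s * p) = 1).

Let sV : s^-1 = s.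
Proof. by apply: (mulIg s); rewrite mulVg. Qed.

(** Closure under left multiplication by s relies on s p being the element of
    order three, so that s s p = p and s (s p)^-1 = s p^-1 s. *)
Lemma normal_form_sl o m b : exists o' m' b',
  s * normal_form s p o m b = normal_form s p o' m' b'.
Proof.
rewrite /normal_form; case: o => [[]|].
- by exists None, (true :: m), b; rewrite /= !mulgA s2 !mul1g.
- by exists None, (false :: m), b; rewrite /= invgM sV !mulgA !mul1g.
case: m => [|[] m] /=.
- case: b; last by exists None, [::], true; rewrite /= !mul1g mulg1.
  by exists None, [::], false; rewrite /= !mul1g s2.
- by exists (Some true), m, b; rewrite /= mul1g !mulgA.
- by exists (Some false), m, b; rewrite /= invgM sV mul1g !mulgA s2 mul1g.
Qed.

Lemma normal_form_spl o m b : exists o' m' b',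
  s * p * normal_form s p o m b = normal_form s p o' m' b'.
Proof.
rewrite /normal_form; case: o => [[]|].
- have V : (s * p)^-1 = s * p * (s * p) by apply: (mulIg (s * p)); rewrite mulVg sp3.
  by exists (Some false), m, b; rewrite /= V !mulgA.
- by exists None, m, b; rewrite /=; move: (s * p) => x; rewrite !mulgA mulgV.
- by exists (Some true), m, b; rewrite /= mul1g !mulgA.
Qed.

End Closure.

Lemma PSL2Z_mul_pi (v w : word) :
  (\pi_PSL2Z%qT v : PSL2Z) * \pi_PSL2Z%qT w = \pi_PSL2Z%qT (v ++ w).
Proof. by apply/PSL2Z_eqP/word_eq_cat; exact: PSL2Z_repr. Qed.

Lemma PSL2Z_a2a2 : PSL2Z_gen a2 * PSL2Z_gen a2 = 1.
Proof. by rewrite PSL2Z_mul_pi; apply/PSL2Z_eqP/word_eq_a2. Qed.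

Lemma PSL2Z_a2a0 : PSL2Z_gen a2 * PSL2Z_gen a0 = PSL2Z_gen a1.
Proof.
have <- : PSL2Z_gen a2 * PSL2Z_gen a1 = PSL2Z_gen a0.
  by rewrite PSL2Z_mul_pi; apply/PSL2Z_eqP/word_eq_a0.
by rewrite mulgA PSL2Z_a2a2 mul1g.
Qed.

Lemma PSL2Z_a1_cube : PSL2Z_gen a1 * PSL2Z_gen a1 * PSL2Z_gen a1 = 1.
Proof.
rewrite (PSL2Z_mul_pi [:: (a1, false)] [:: (a1, false)]).
by rewrite (PSL2Z_mul_pi _ [:: (a1, false)]); apply/PSL2Z_eqP; exact: word_eq_a1.
 Qed.

Lemma PSL2Z_normal_form (g : PSL2Z) : exists o m b,
  g = normal_form (PSL2Z_gen a2) (PSL2Z_gen a0) o m b.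
Proof.
set s := PSL2Z_gen a2; set p := PSL2Z_gen a0.
have sl x : (exists o m b, x = normal_form s p o m b) ->
    exists o m b, s * x = normal_form s p o m b.
  by move=> [c [m [b ->]]]; exact: normal_form_sl PSL2Z_a2a2 _ _ _.
have spl x : (exists o m b, x = normal_form s p o m b) ->
    exists o m b, PSL2Z_gen a1 * x = normal_form s p o m b.
  move=> [c [m [b ->]]]; rewrite -PSL2Z_a2a0.
  by apply: normal_form_spl; rewrite PSL2Z_a2a0 PSL2Z_a1_cube.
rewrite -[g]reprK; elim: (repr g) => [|[j e] w IH].
  by exists None, [::], false; rewrite /normal_form /= !mulg1.
have -> : (\pi_PSL2Z%qT ((j, e) :: w) : PSL2Z) =
    (if e then (PSL2Z_gen j)^-1 else PSL2Z_gen j) * \pi_PSL2Z%qT w.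
  rewrite -cat1s -PSL2Z_mul_pi; congr (_ * _); case: e => //.
  apply: (mulgI (PSL2Z_gen j)); rewrite mulgV PSL2Z_mul_pi.
  exact/PSL2Z_eqP/(word_eq_cancel j false).
have sV : s^-1 = s by apply: (mulIg s); rewrite mulVg PSL2Z_a2a2.
have a1V : (PSL2Z_gen a1)^-1 = PSL2Z_gen a1 * PSL2Z_gen a1.
  by apply: (mulIg (PSL2Z_gen a1)); rewrite mulVg PSL2Z_a1_cube.
have pE : p = s * PSL2Z_gen a1 by rewrite -PSL2Z_a2a0 mulgA PSL2Z_a2a2 mul1g.
have pV : p^-1 = PSL2Z_gen a1 * PSL2Z_gen a1 * s by rewrite pE invgM sV a1V.
case: j e => [] [].
- by rewrite -/p pV -!mulgA; auto.
- by rewrite -/p [X in X * _]pE -!mulgA; auto.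
- by rewrite a1V -!mulgA; auto.
- exact: spl.
- by rewrite -/s sV; exact: sl.
- exact: sl.
Qed.

Lemma normal_form_morph (G H : groupType) (f : G -> H) (s p : G) o m b :
  {morph f : x y / x * y} ->
  f (normal_form s p o m b) = normal_form (f s) (f p) o m b.
Proof.
move=> fM.
have f1 : f 1 = 1 by apply: (mulIg (f 1)); rewrite -fM !mul1g.
have fV x : f x^-1 = (f x)^-1 by apply: (mulIg (f x)); rewrite -fM !mulVg.
have fc : f (corner s p o) = corner (f s) (f p) o.
  by case: o => [[]|] /=; rewrite ?fV ?fM.
have fw : f (parabolic_word s p m) = parabolic_word (f s) (f p) m.
  by elim: m => //= -[] m IH; rewrite !fM IH ?fV.
by rewrite /normal_form !fM fc fw; case: b; rewrite ?f1.
Qed.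

End NormalForm.

(** * Ping-pong and discreteness *)

Section DiscretenessCriterion.
Local Open Scope complex_scope.
Variables (R : realType) (G : groupType) (f : G -> PU31 R).
Variable Q : 'M[R[i]]_4 -> Prop.
Hypotheses (fM : {morph f : x y / (x * y)%g})
  (QZ : forall (c : R[i]) M, c != 0 -> Q M -> Q (c *: M))
  (Q1 : Q 1%:M)
  (Qopen : forall B : 'M[R[i]]_4, open [set h : U31 R | Q (B *m U31_val h)])
  (Qf : forall g (M : U31 R), f g = PU31_class M -> Q M -> g = 1%g).

(** A homomorphism to PU(3,1) is discrete and injective as soon as a homogeneous
    open condition satisfied by the identity is satisfied, on its image, only by
    the image of the trivial element. *)
Lemma discrete_faithful_criterion : discrete_image f /\ injective f.
Proof.
have f1 : f 1%g = 1%g by apply: (mulIg (f 1%g)); rewrite -fM !mul1g.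
have fV g : f g^-1%g = (f g)^-1%g.
  by apply: (mulIg (f g)); rewrite -fM !mulVg.
have sep g g' (A A' : U31 R) : f g = PU31_class A -> f g' = PU31_class A' ->
    Q (invmx A *m A') -> g = g'.
  move=> gA gA' n1; apply: (mulgI g^-1%g); rewrite mulVg.
  apply/esym/(Qf (M := (A^-1 * A')%g)) => //.
  rewrite fM fV gA gA' -PU31_mulE; congr (_ * _)%g.
  by apply: (mulIg (PU31_class A)); rewrite mulVg PU31_mulE mulVg.
have n1 (A : U31 R) : Q (invmx A *m A).
  by rewrite mulVmx//; apply: unitary31_unitmx; exact: U31_prop.
split; last first.
  move=> g g' gg'.
  by apply: (sep _ _ (repr (f g)) (repr (f g))); rewrite ?PU31_reprK.
move=> _ [g _ <-]; split; first by apply/mem_set; exists g.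
set A : U31 R := repr (f g).
exists [set x : PU31 R | Q (invmx A *m U31_val (repr x))].
  apply: open_nbhs_nbhs; split; last exact: n1.
  rewrite /open /= /quotient_open.
  rewrite (_ : _ @^-1` _ = [set h : U31 R | Q (invmx A *m U31_val h)]).
    exact: Qopen.
  (* a class and its chosen representative differ by a scalar *)
  apply/seteqP; split=> h /=.
    have /PU31_eqP[c c0 E] := esym (PU31_reprK (PU31_class h)).
    by move=> /(QZ c0); rewrite scalemxAr -E.
  have /PU31_eqP[c c0 E] := PU31_reprK (PU31_class h).
  by move=> /(QZ c0); rewrite scalemxAr -E.
apply/seteqP; split=> [x [nx [g' _ xE]]|x ->]; last first.
  by split; [exact: n1|exists g].
rewrite /= -xE; congr f; apply/esym.
by apply: (sep _ _ A (repr x)) => //; rewrite PU31_reprK.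
Qed.

End DiscretenessCriterion.

Section PingPong.
Local Open Scope complex_scope.

(** The quantitative closeness to alpha = pi / 2 under which the ping-pong
    works: the transverse part of the parabolic generator has no eigenvalue 1,
    its off-diagonal entries are small compared with the resulting
    determinant, and e^(i alpha) is close to i. *)
Definition near_cusp (R : realType) (alpha beta : R) : Prop :=
  let D := par_det (expi alpha) (- expi (alpha / 3)) (cos beta) (sin beta) in
  [/\ D != 0, 400 * (400 * sqc (u alpha)) <= sqc D, sqc (u alpha) <= 1 &
      100 * (50 * sqc ('i - expi alpha)) <= 1].

Variables (R : realType) (p : square R).
Implicit Types z : 'cV[R[i]]_4.

(** Representatives in U(3,1) of the images of a2 and a0. *)
Definition involution : U31 R :=
  MkU31 (unitary31_mul (U31_prop (U1 R)) (U31_prop (U0 R))).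
Definition parabolic : U31 R :=
  MkU31 (unitary31_mul (U31_prop (U1 R)) (unitary31_conj (U31_prop (U2 p)))).

Let S : 'M[R[i]]_4 := involution.
Let P : 'M[R[i]]_4 := parabolic.

Lemma rho_a2_class : rho p (PSL2Z_gen a2) = PU31_class involution.
Proof.
by rewrite rho_genE; congr PU31_class; apply/val_inj; rewrite /= conjmx_M0.
Qed.

Lemma rho_a0_class : rho p (PSL2Z_gen a0) = PU31_class parabolic.
Proof. exact: rho_genE. Qed.

Lemma rhoM : {morph rho p : x y / (x * y)%g}.
Proof. exact: (PSL2Z_liftM (rho_a2 p) (rho_a1 p) (rho_a0 p)). Qed.

Lemma involution_sqr : S *m S = 1%:M.
Proof.
rewrite /S /=.
by rewrite [X in X *m _]M1_M0 mulmxA -(mulmxA (M0 R)) M1_sqr mulmx1 M0_sqr.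
Qed.

(** The vector e_0 - e_3 represents a fixed point of the involution that lies on
    the wall. *)
Definition basepoint : 'cV[R[i]]_4 := delta_mx 0 0 - delta_mx 3 0.

Lemma basepointE : [/\ basepoint 0 0 = 1, basepoint 1 0 = 0, basepoint 2 0 = 0 &
  basepoint 3 0 = -1].
Proof. by rewrite !mxE /= ?subr0 ?sub0r. Qed.

Lemma involution_basepoint : S *m basepoint = - basepoint.
Proof.
have [b0 b1 b2 b3] := basepointE; have [s0 s1 s2 s3] := A2_mulv basepoint.
apply/matrixP => i j; rewrite ord1 [RHS]mxE; move: i => [[|[|[|[|//]]]] i4].
- by rewrite (_ : Ordinal _ = 0) ?b0 ?s0 ?b3//; exact: val_inj.
- by rewrite (_ : Ordinal _ = 1) ?b1 ?s1 ?b1//; exact: val_inj.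
- by rewrite (_ : Ordinal _ = 2) ?b2 ?s2 ?b2 ?oppr0//; exact: val_inj.
- by rewrite (_ : Ordinal _ = 3) ?b3 ?s3 ?b0 ?opprK//; exact: val_inj.
Qed.

Lemma wallZ (c : R[i]) z : wall (c *: z) = sqc c * wall z.
Proof.
rewrite /wall !mxE; move: c (z 0 0) (z 3 0) => [c1 c2] [x1 x2] [y1 y2].
by rewrite /sqc /=; ring.
Qed.

Lemma wall_basepoint : wall basepoint = 0.
Proof. by have [b0 _ _ b3] := basepointE; rewrite /wall b0 b3 /=; ring. Qed.

Lemma cone_in_basepoint e : cone_in e basepoint.
Proof.
have [b0 b1 b2 b3] := basepointE.
by rewrite /cone_in /transv wall_basepoint b0 b1 b2 b3 sqcN mulr0 sqc0 sqc1;
  split; lra.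
Qed.

Lemma cone_inN e z : cone_in e z -> cone_in e (- z).
Proof.
rewrite -scaleN1r /cone_in /transv wallZ !mxE !mulN1r !sqcN => -[q h v].
by rewrite sqc1 mul1r.
Qed.

Lemma wall_involution z : wall (S *m z) = - wall z.
Proof.
have [E0 _ _ E3] := A2_mulv z; rewrite /wall E0 E3.
by move: (z 0 0) (z 3 0) => [p1 r1] [p2 r2] /=; ring.
Qed.

Hypothesis near : near_cusp (\val p).1 (\val p).2.

Let orbit := par_orbit (expi (\val p).1) (- expi ((\val p).1 / 3))
  (u (\val p).1)^* (cos (\val p).2) (sin (\val p).2).

Lemma orbit_cone (e n : R) z z' : e ^+ 2 = 1 -> 1 <= n ->
  orbit (e * n) z z' -> cone_in e z -> cone_out e z'.
Proof.
have [D0 wD w1 ai] := near.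
apply: par_orbit_cone; rewrite ?sqcN ?sqc_expi ?sqc_conj ?cos2Dsin2 //.
Qed.

(** The parabolic generator or its inverse, according to the sign e. *)
Definition turn (e : bool) : 'M[R[i]]_4 := if e then P else invmx P.

Let sgn (e : bool) : R := if e then 1 else -1.

Lemma turn_orbit e z : orbit (sgn e) z (turn e *m z).
Proof.
have [D0 _ _ _] := near.
have st z' : orbit 1 z' (P *m z').
  apply: par_rel_orbit; rewrite ?sqcN ?sqc_expi ?cos2Dsin2 //.
  exact: A0_par_rel.
have uP : P \in unitmx by apply: unitary31_unitmx; exact: U31_prop parabolic.
by case: e => //=; apply: par_orbitN; have := st (invmx P *m z); rewrite mulKVmx.
Qed.

(** The vectors reached from cone_in by a positive number of turns of sign e.
    Recording the whole run of turns avoids any loss accumulating with n. *)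
Definition turning (e : bool) z : Prop :=
  exists (n : nat) z', cone_in (sgn e) z' /\ orbit (sgn e * n.+1%:R) z' z.

Lemma turning_cone_out e z : turning e z -> cone_out (sgn e) z.
Proof.
case=> n [z' [bz' oz]]; apply: (orbit_cone _ _ oz bz').
- by case: e {bz' oz} => /=; rewrite ?sqrrN expr1n.
- by rewrite ler1n.
Qed.

Lemma turning_start e z : cone_in (sgn e) z -> turning e (turn e *m z).
Proof. by move=> bz; exists 0%N, z; split=> //; rewrite mulr1; exact: turn_orbit. Qed.

Lemma turning_turn e z : turning e z -> turning e (turn e *m z).
Proof.
case=> n [z' [bz' oz]]; exists n.+1, z'; split=> //.
have := par_orbitD oz (turn_orbit e z).
by rewrite -[n.+2]addn1 natrD mulrDr mulr1.
Qed.

Lemma turning_involution e z : turning e z -> cone_in (sgn (~~ e)) (S *m z).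
Proof.
move=> /turning_cone_out/A2_cone; congr cone_in.
by case: e; rewrite /= ?opprK.
Qed.

(** The invariant attached to the last letter of a word; the mirror letter is
    transported to the parabolic one by the involution. *)
Definition pong (e : bool) z : Prop :=
  if e then turning true z else turning false (S *m z).

Let SS z : S *m (S *m z) = z.
Proof. by rewrite mulmxA involution_sqr mul1mx. Qed.

Lemma pong_step e z :
  (cone_in 1 z /\ cone_in (-1) (S *m z)) \/ (exists e', pong e' z) ->
  pong e (if e then P *m z else S *m (invmx P *m (S *m z))).
Proof.
case=> [[bz bSz]|[e' pz]]; case: e; rewrite /pong ?SS.
- exact: (@turning_start true z).
- exact: (@turning_start false (S *m z)).
- case: e' pz => pz; first exact: (@turning_turn true).
  by apply: (@turning_start true); have := turning_involution pz; rewrite SS.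
- case: e' pz => pz; last exact: (@turning_turn false).
  by apply: (@turning_start false); exact: turning_involution pz.
Qed.

Local Notation word_mx m := (U31_val (parabolic_word involution parabolic m)).

Lemma parabolic_word_pong e m : pong e (word_mx (e :: m) *m basepoint).
Proof.
have cons e' m' : word_mx (e' :: m') *m basepoint =
    let z := word_mx m' *m basepoint in
    if e' then P *m z else S *m (invmx P *m (S *m z)).
  by case: e'; rewrite /= ?mulmxA.
elim: m e => [|e' m IH] e; rewrite cons; apply: pong_step; last by right; exists e'.
rewrite /= mul1mx; left; split; first exact: cone_in_basepoint.
by rewrite involution_basepoint; exact/cone_inN/cone_in_basepoint.
Qed.

Lemma pong_wall e z : pong e z ->
  0 <= wall z /\ (sqc (z 3 0) <= 2 * wall z \/ sqc (z 0 0) <= 2 * wall z).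
Proof.
have [_ _ _ E3] := A2_mulv z.
case: e => /turning_cone_out [] /=.
  by rewrite mul1r => h _ _; have := sqc_ge0 (z 3 0); split; [lra|left].
rewrite wall_involution mulN1r opprK E3 => h _ _.
by have := sqc_ge0 (z 0 0); split; [lra|right].
Qed.

(** Open conditions, invariant under rescaling, which exclude the images of the
    base point: v and w stand for M e_0 and M basepoint, C and C' for the element
    of order three and its inverse. *)
Definition near_vec (C C' : 'M[R[i]]_4) (v w : 'cV[R[i]]_4) : Prop :=
  [/\ 0 < sqc (v 0 0), 0 < sqc (w 3 0) - 2 * wall w, 0 < sqc (w 0 0) - 2 * wall w,
     0 < - wall (C *m w) & 0 < - wall (C' *m w)].

Lemma near_vecZ C C' (c : R[i]) v w : c != 0 ->
  near_vec C C' v w -> near_vec C C' (c *: v) (c *: w).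
Proof.
move=> /sqc_gt0 c0 [h1 h2 h3 h4 h5].
have ez (z : 'cV_4) i : sqc ((c *: z) i 0) = sqc c * sqc (z i 0).
  by rewrite mxE sqcM.
rewrite /near_vec -!scalemxAr !ez !wallZ !(mulrCA 2) -!mulrBr.
by rewrite -!(mulrN (sqc c)); split; exact: mulr_gt0.
Qed.

(** The matrices M in a neighbourhood of the identity met by the image of the
    representation only at the identity. *)
Definition near_one (M : 'M[R[i]]_4) : Prop :=
  near_vec (S *m P) (invmx (S *m P))
    (M *m (delta_mx 0 0 : 'cV_4)) (M *m basepoint).

Lemma near_oneZ (c : R[i]) M : c != 0 -> near_one M -> near_one (c *: M).
Proof. by move=> c0 n1; rewrite /near_one -!scalemxAl; exact: near_vecZ. Qed.

Let uS : S \in unitmx.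
Proof. by apply: unitary31_unitmx; exact: U31_prop involution. Qed.
Let uP : P \in unitmx.
Proof. by apply: unitary31_unitmx; exact: U31_prop parabolic. Qed.

Lemma near_one1 : near_one 1%:M.
Proof.
have [b0 _ _ b3] := basepointE.
have turn_neg e : 1 <= 2 * (sgn e * wall (turn e *m basepoint)).
  have [/= h _ _] := turning_cone_out (turning_start (cone_in_basepoint (sgn e))).
  have [_ _ E3] := turn_orbit e basepoint.
  by rewrite E3 b3 sqcN sqc1 in h.
rewrite /near_one /near_vec !mul1mx wall_basepoint b0 b3 sqcN sqc1 mulr0
  subr0 ltr01; split=> //.
- by rewrite !mxE /= sqc1 ltr01.
- rewrite -mulmxA wall_involution opprK.
  by have := turn_neg true; rewrite /sgn /turn; lra.
- have uSP : S *m P \in unitmx by rewrite unitmx_mul uS.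
  have -> : invmx (S *m P) = invmx P *m S.
    apply: (can_inj (mulKmx uSP)).
    rewrite mulmxV// mulmxA -(mulmxA S) mulmxV// mulmx1.
    by rewrite involution_sqr.
  have fN z : wall (- z) = wall z by rewrite -scaleN1r wallZ sqcN sqc1 mul1r.
  rewrite -mulmxA involution_basepoint mulmxN fN.
  by have := turn_neg false; rewrite /sgn /turn; lra.
Qed.

(** The first condition of near_one excludes the involution, the next two exclude
    words with at least one parabolic letter, and the last two exclude elements
    whose normal form starts with a nontrivial corner, since the base point and
    its images by words all satisfy 0 <= wall. *)
Lemma near_one_rho (g : PSL2Z) (M : U31 R) :
  rho p g = PU31_class M -> near_one M -> g = 1%g.
Proof.
have [k [m [b ->]]] := PSL2Z_normal_form g.
rewrite (normal_form_morph _ _ _ _ _ rhoM) rho_a2_class rho_a0_class.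
rewrite -(normal_form_morph (f := @PU31_class R)); last first.
  by move=> A B; rewrite PU31_mulE.
move=> /PU31_eqP[c c0 E] nM; have := near_oneZ c0 nM; rewrite -{}E {c c0 M nM}.
pose d : R[i] := if b then -1 else 1.
have d0 : d != 0 by rewrite /d; case: (b); rewrite ?oppr_eq0 oner_eq0.
have dd : d * d = 1 by rewrite /d; case: (b); rewrite ?mulrNN mulr1.
have E : U31_val (normal_form involution parabolic k m b) *m basepoint =
    d *: (U31_val (corner involution parabolic k) *m (word_mx m *m basepoint)).
  rewrite /normal_form /d /= -!mulmxA; case: b {d d0 dd} => /=.
    by rewrite -/S involution_basepoint scaleN1r !mulmxN.
  by rewrite mul1mx scale1r.
have fW : 0 <= wall (word_mx m *m basepoint).
  case: m {E} => [|e m]; first by rewrite /= mul1mx wall_basepoint.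
  by have [] := pong_wall (parabolic_word_pong e m).
rewrite /near_one {}E => /(near_vecZ d0).
rewrite scalerA dd scale1r => -[h1 h2 h3 h4 h5].
have uSP : S *m P \in unitmx by rewrite unitmx_mul uS.
case: k => [[]|] in h1 h2 h3 h4 h5 *.
- by move: h5; rewrite -/(S *m P) mulKmx// oppr_gt0 ltNge fW.
- by move: h4; rewrite -/(invmx (S *m P)) mulKVmx// oppr_gt0 ltNge fW.
rewrite [U31_val (corner _ _ _)]/= !mul1mx in h2 h3 {h4 h5}.
case: m => [|e m] in fW h1 h2 h3 *.
  case: b @d d0 dd h1 {h2 h3} => /= d0 dd h1; last by rewrite /normal_form /= !mulg1.
  have [s0 _ _ _] := A2_mulv (delta_mx 0 0 : 'cV[R[i]]_4).
  move: h1; rewrite /normal_form /= !mul1mx mxE s0 mxE /= mulr0.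
  by rewrite sqc0 ltxx.
have [_ []] := pong_wall (parabolic_word_pong e m).
- by move: h2; rewrite subr_gt0 => /lt_le_trans h /h; rewrite ltxx.
- by move: h3; rewrite subr_gt0 => /lt_le_trans h /h; rewrite ltxx.
Qed.

Lemma near_one_open (B : 'M[R[i]]_4) :
  open [set h : U31 R | near_one (B *m U31_val h)].
Proof.
have orb z := U31_orbit_continuous B z.
pose w (h : U31 R) := B *m U31_val h *m basepoint.
have fc (C : 'M[R[i]]_4) : continuous (fun h => wall (C *m w h)).
  apply: continuous_wall => i.
  under eq_fun do rewrite /w -(mulmxA B) (mulmxA C).
  exact: U31_orbit_continuous.
have fc1 : continuous (fun h => wall (w h)).
  apply: continuous_wall => i.
  by under eq_fun do rewrite /w -(mulmxA B); exact: orb.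
have sc z i : continuous (fun h : U31 R => sqc ((B *m U31_val h *m z) i 0)).
  by apply: continuous_sqc; under eq_fun do rewrite -(mulmxA B); exact: orb.
rewrite (_ : [set h | _] =
  [set h : U31 R | 0 < sqc ((B *m U31_val h *m (delta_mx 0 0 : 'cV_4)) 0 0)] `&`
  ([set h : U31 R | 0 < sqc (w h 3 0) - 2 * wall (w h)] `&`
  ([set h : U31 R | 0 < sqc (w h 0 0) - 2 * wall (w h)] `&`
  ([set h : U31 R | 0 < - wall (S *m P *m w h)] `&`
   [set h : U31 R | 0 < - wall (invmx (S *m P) *m w h)])))); last first.
  by apply/seteqP; split=> h; [case=> ? ? ? ? ?|case=> ? [? [? []]]].
apply: openI; first by apply: open_pos; exact: sc.
apply: openI.
  by apply: open_pos; apply: continuous_sub2; [exact: sc|exact: fc1].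
apply: openI.
  by apply: open_pos; apply: continuous_sub2; [exact: sc|exact: fc1].
by apply: openI; apply: open_pos; apply: continuous_opp; exact: fc.
Qed.

Theorem rho_discrete_faithful : discrete_image (rho p) /\ faithful (rho p).
Proof.
exact: (discrete_faithful_criterion rhoM near_oneZ near_one1 near_one_open
  near_one_rho).
Qed.

End PingPong.

(** * Parameters near alpha = pi / 2 *)

Section NearCusp.
Local Open Scope complex_scope.
Variable R : realType.

Lemma sqc_u (alpha : R) : 0 <= cos alpha -> sqc (u alpha) = 2 * cos alpha.
Proof.
move=> ca; rewrite /u !sqcM.
rewrite sqc_expi sqc_real sqr_sqrtr ?mulr_ge0//.
by rewrite /sqc /= expr0n expr1n add0r !mul1r.
Qed.

Lemma sqc_i_expi (alpha : R) : sqc ('i - expi alpha) = 2 - 2 * sin alpha.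
Proof.
have := cos2Dsin2 alpha; rewrite /sqc /expi /=; move: (cos _) (sin _) => c s; lra.
Qed.

(** par_det as a function of t = (alpha, beta). *)
Definition cusp_det (t : R * R) : R[i] :=
  par_det (expi t.1) (- expi (t.1 / 3)) (cos t.2) (sin t.2).

Lemma cos_pi6 : cos (pi / 2 / 3 : R) ^+ 2 = 3 / 4.
Proof.
set x := pi / 2 / 3.
have x0 : 0 < cos x.
  by apply: cos_gt0_pihalf; rewrite /x; have := pi_gt0 R; lra.
(* cos (3 x) = 0 with cos x > 0 determines cos x *)
have h : cos (x + (x + x)) = 0.
  by rewrite -[RHS](@cos_pihalf R); congr cos; rewrite /x; field.
rewrite !cosD !sinD in h.
have := cos2Dsin2 x; move: h x0; move: (cos x) (sin x) => c s h c0 cs.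
have s2 : s ^+ 2 = 1 - c ^+ 2 by lra.
have {}h : c * (4 * c ^+ 2 - 3) = 0.
  rewrite -[RHS]h; transitivity (c ^+ 3 - 3 * (c * s ^+ 2)); last by ring.
  by rewrite s2; ring.
by move/eqP: h; rewrite mulf_eq0 gt_eqF//= => /eqP; lra.
Qed.

Lemma sin_pi6 : sin (pi / 2 / 3 : R) = 1 / 2.
Proof.
have := cos2Dsin2 (pi / 2 / 3 : R); rewrite cos_pi6 => h.
have : 0 < sin (pi / 2 / 3 : R) by apply: sin_gt0_pi; have := pi_gt0 R; lra.
move: h; move: (sin _) => s h s0.
have : (s - 1 / 2) * (s + 1 / 2) = 0.
  by transitivity (s ^+ 2 - 1 / 4); [field|lra].
by move/eqP; rewrite mulf_eq0 => /orP[]/eqP; lra.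
Qed.

(** At alpha = pi / 2 the determinant is e^(i pi / 3) (1 + sqrt 3 cos (2 beta));
    it vanishes exactly at the excluded angle, where the transverse part of the
    parabolic generator acquires the eigenvalue 1. *)
Lemma cusp_det_eq0 (beta : R) : cusp_det (pi / 2, beta) = 0 ->
  cos (2 * beta) = - (1 / Num.sqrt 3).
Proof.
have -> : cos (2 * beta) = cos beta ^+ 2 - sin beta ^+ 2.
  by rewrite mulr_natl mulr2n cosD !expr2.
rewrite /cusp_det /par_det /expi /= cos_pihalf sin_pihalf sin_pi6.
have := cos_pi6; set C := cos beta ^+ 2 - _.
have c0 : 0 < cos (pi / 2 / 3 : R).
  by apply: cos_gt0_pihalf; have := pi_gt0 R; lra.
move: (cos _) c0 => c c0 c2 [h1 h2].
have s3 : Num.sqrt 3 = 2 * c.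
  rewrite (_ : 3 = (2 * c) ^+ 2); last by rewrite exprMn c2; lra.
  by rewrite sqrtr_sqr gtr0_norm// mulr_gt0.
rewrite s3.
have {}h2 : C = - (2 / 3) * c by lra.
rewrite h2; have : c * c = 3 / 4 by rewrite -expr2.
move=> cc; apply: (mulIf (lt0r_neq0 c0)).
rewrite -mulrA cc; field; exact: lt0r_neq0.
Qed.

Lemma cusp_det_continuous : ccontinuous cusp_det.
Proof.
have c1 : continuous (fun t : R * R => t.1) by move=> t; exact: cvg_fst.
have c2 : continuous (fun t : R * R => t.2) by move=> t; exact: cvg_snd.
have cos_c (f : R * R -> R) : continuous f -> continuous (fun t => cos (f t)).
  move=> fc t; apply: (@continuous_comp _ _ _ f (@cos R)); first exact: fc.
  exact: continuous_cos.
have sin_c (f : R * R -> R) : continuous f -> continuous (fun t => sin (f t)).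
  move=> fc t; apply: (@continuous_comp _ _ _ f (@sin R)); first exact: fc.
  exact: continuous_sin.
have expi_c (f : R * R -> R) : continuous f -> ccontinuous (fun t => expi (f t)).
  by move=> fc; split=> t /=; [exact: cos_c|exact: sin_c].
have opp_c (f : R * R -> R[i]) : ccontinuous f -> ccontinuous (fun t => - f t).
  move=> fc; under eq_fun do rewrite -mulN1r.
  by apply: ccontinuousM => //; exact: ccontinuous_cst.
have c13 : continuous (fun t : R * R => t.1 / 3).
  by move=> t; apply: cvgM; [exact: c1|exact: cvg_cst].
have e1 := expi_c _ c1; have e2 := opp_c _ (expi_c _ c13).
rewrite /cusp_det /par_det.
apply: ccontinuousD; last by apply: opp_c; exact: ccontinuousM.
apply: ccontinuousD; first exact: ccontinuous_cst.
apply: ccontinuousM; first by apply: ccontinuousD => //; exact: opp_c.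
split=> t /=; last exact: cvg_cst.
apply: cvgB; under eq_fun do rewrite expr2; apply: cvgM.
- exact: cos_c.
- exact: cos_c.
- exact: sin_c.
- exact: sin_c.
Qed.

(** An explicit open set on which near_cusp holds, written with continuous
    functions of (alpha, beta), since |u|^2 = 2 cos alpha and
    |i - e^(i alpha)|^2 = 2 - 2 sin alpha. *)
Definition cusp_nbhd : set (R * R) :=
  [set t | 0 < sqc (cusp_det t) - 2 * (400 * (400 * cos t.1))] `&`
  ([set t | 0 < 1 - 2 * cos t.1] `&`
   [set t | 0 < sin t.1 - 2 * (1 / 2 - 1 / 200 / 200)]).

Lemma cusp_nbhd_open : open cusp_nbhd.
Proof.
have cos_c : continuous (fun t : R * R => cos t.1).
  move=> t; apply: (@continuous_comp _ _ _ (@fst R R) (@cos R)).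
    exact: cvg_fst.
  exact: continuous_cos.
have sin_c : continuous (fun t : R * R => sin t.1).
  move=> t; apply: (@continuous_comp _ _ _ (@fst R R) (@sin R)).
    exact: cvg_fst.
  exact: continuous_sin.
have cst_c (x : R) : continuous (fun _ : R * R => x) by move=> t; exact: cvg_cst.
apply: openI; last apply: openI; apply: open_pos; apply: continuous_sub2 => //.
- exact: continuous_sqc cusp_det_continuous.
- move=> t; apply: cvgM; first exact: cvg_cst.
  by apply: cvgM; [exact: cvg_cst|exact: cos_c].
Qed.

Lemma cusp_nbhd_near (t : R * R) : 0 <= cos t.1 -> cusp_nbhd t -> near_cusp t.1 t.2.
Proof.
move=> c0 [/= h1 [h2 h3]]; rewrite /near_cusp sqc_u// sqc_i_expi -/(cusp_det t).
split; [|lra|lra|lra].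
apply/eqP => D0; move: h1; rewrite D0 sqc0; lra.
Qed.

Lemma cusp_nbhd_pihalf (beta : R) :
  cos (2 * beta) != - (1 / Num.sqrt 3) -> cusp_nbhd (pi / 2, beta).
Proof.
move=> b; have D0 : cusp_det (pi / 2, beta) != 0.
  by apply: contra b => /eqP/cusp_det_eq0->.
rewrite /cusp_nbhd /= cos_pihalf sin_pihalf !mulr0 !subr0; split; first exact: sqc_gt0.
by split; [exact: ltr01|lra].
Qed.

End NearCusp.

Theorem corollary4p13 (R : realType) (beta0 : R)
    (beta0_in : beta0 \in `[0, pi / 2])
    (beta0E : cos (2 * beta0) = - (1 / Num.sqrt 3))
    (beta : R) (beta_in : beta \in `[0, pi / 2]) (beta_neq : beta <> beta0) :
  exists2 N : set (square R),
    nbhs (square_pt (pihalf_in R) beta_in) N &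
    forall p : square R, N p -> discrete_image (rho p) /\ faithful (rho p).
Proof.
exists [set p : square R | cusp_nbhd (\val p)]; last first.
  move=> p pN; apply: rho_discrete_faithful; apply: cusp_nbhd_near => //.
  exact: square_cos_ge0.
have two_in (b : R) : b \in `[0, pi / 2] -> 2 * b \in `[0, pi].
  by rewrite !in_itv /= => /andP[b0 b1]; apply/andP; split; lra.
have nb : cusp_nbhd (pi / 2, beta).
  apply: cusp_nbhd_pihalf; apply/eqP; rewrite -beta0E.
  by move/(cos_inj (two_in _ beta_in) (two_in _ beta0_in)); lra.
apply: open_nbhs_nbhs; split; last exact: nb.
have vc : continuous (fun p : square R => \val p) by exact: initial_continuous.
apply: (@open_comp _ _ (fun p : square R => \val p) (@cusp_nbhd R)); last first.
  exact: cusp_nbhd_open.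
by move=> p _; exact: vc.
Qed.
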